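(* Let $n\ge 2$. A functional $\Psi:\mathcal{P}^n \to \mathbb{R}$ is an $\mathrm{SL}(n)$ invariant valuation if and only if there are constants $c_0, c_0', d_0\in\mathbb{R}$ and solutions $\phi,\psi:[0,\infty)\to \mathbb{R}$ of Cauchy's functional equation such that $$\Psi (P)= c_0 \,V_0(P) + c_0'\, (-1)^{\dim P}\, \mathbf{1}_{\operatorname{relint} P} (0) + \psi\big(V_n(P)\big)+d_0\, \mathbf{1}_{P}(0) + \phi\big( V_n([0,P])\big)$$ for every $P\in\mathcal{P}^n$.
   Context: $\mathcal{P}^n$ is the set of (nonempty) convex polytopes in $\mathbb{R}^n$. A functional $\Psi:\mathcal{S}\to\mathbb{R}$ on a collection $\mathcal{S}$ of sets is a valuation if $\Psi(P)+\Psi(Q)=\Psi(P\cup Q)+\Psi(P\cap Q)$ whenever $P,Q,P\cap Q,P\cup Q\in\mathcal{S}$. It is $\mathrm{SL}(n)$ invariant if $\Psi(AP)=\Psi(P)$ for every $A\in\mathrm{SL}(n)$ (the real $n\times n$ matrices of determinant $1$) and $P\in\mathcal{S}$. $V_n$ is $n$-dimensional volume and $V_0$ is the Euler characteristic, i.e. $V_0(P)=1$ for every nonempty polytope $P$. $\dim P$ is the dimension of the affine hull of $P$, $\operatorname{relint} P$ is the interior of $P$ relative to its affine hull, $\mathbf{1}_Q$ is the indicator function of $Q\subset\mathbb{R}^n$, and $[0,P]$ is the convex hull of the origin $0$ and $P$. A function $\psi:[0,\infty)\to\mathbb{R}$ is a solution of Cauchy's functional equation if $\psi(x+y)=\psi(x)+\psi(y)$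 for all $x,y\in[0,\infty)$; no regularity is assumed. *)

(* Defs.v *)
From HB Require Import structures.
From mathcomp Require Import all_boot all_order all_algebra.
From mathcomp Require Import all_classical all_reals all_analysis.

Set Implicit Arguments.
Unset Strict Implicit.
Unset Printing Implicit Defensive.

Import Order.TTheory GRing.Theory Num.Theory.
Import numFieldNormedType.Exports.

Local Open Scope classical_set_scope.
Local Open Scope ring_scope.

(* The n-fold product of the Lebesgue measure on the Borel sets of R. *)
Fixpoint lebesgue_tuple (R : realType) (n : nat) :
    set (n.-tuple (measurableTypeR R)) -> \bar R :=
  match n with
  | 0 => \d_[tuple]
  | m.+1 => pushforward (lebesgue_measure \x lebesgue_tuple (n := m))%E
              (fun x => [tuple of x.1 :: x.2])
  end.

Section lebesgue_tuple_measure.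
Context (R : realType).
Local Notation T := (measurableTypeR R).

Let cons_pair n (x : T * n.-tuple T) : n.+1.-tuple T := [tuple of x.1 :: x.2].

Let measurable_cons_pair n : measurable_fun setT (@cons_pair n).
Proof. exact: measurable_cons. Qed.

Section step.
Context (n : nat) (mu : {sigma_finite_measure set (n.-tuple T) -> \bar R}).

Let prod_leb : {measure set _ -> \bar R} :=
  (lebesgue_measure \x mu)%E.

Let cons_leb := pushforward prod_leb (@cons_pair n).

Let cons_leb0 : cons_leb set0 = 0%E.
Proof. by rewrite /cons_leb /pushforward preimage_set0 measure0. Qed.

Let cons_leb_ge0 A : (0 <= cons_leb A)%E.
Proof. exact: (measure_ge0 prod_leb). Qed.

Let cons_leb_sigma_additive : semi_sigma_additive cons_leb.
Proof.
exact: (@measure_semi_sigma_additive _ _ _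
  (pushforward prod_leb (mfun_Sub (mem_set (@measurable_cons_pair n))))).
Qed.

#[local] HB.instance Definition _ := isMeasure.Build _ _ _ cons_leb
  cons_leb0 cons_leb_ge0 cons_leb_sigma_additive.

Let prod_leb_sigma_finite : sigma_finite setT prod_leb.
Proof.
have /sigma_finiteP[F [TF ndF Foo]] := sigma_finiteT (@lebesgue_measure R).
have /sigma_finiteP[G [TG ndG Goo]] := sigma_finiteT mu.
exists (fun k => F k `*` G k).
  rewrite -setXTT TF TG predeqE => -[x y]; split.
    move=> [/= [i _ Fx] [j _ Gy]]; exists (maxn i j) => //; split.
    - by move: x Fx; exact/subsetPset/ndF/leq_maxl.
    - by move: y Gy; exact/subsetPset/ndG/leq_maxr.
  by move=> [i _ []/= ? ?]; split; exists i.
move=> k; have [? ?] := Foo k; have [? ?] := Goo k.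
split; first exact: measurableX.
have -> : prod_leb (F k `*` G k) = (lebesgue_measure (F k) * mu (G k))%E.
  exact: product_measure1E.
by rewrite lte_mul_pinfty// ge0_fin_numE.
Qed.

Let cons_leb_sigma_finite : sigma_finite setT cons_leb.
Proof.
have [F FT Foo] := prod_leb_sigma_finite.
exists (fun k => (fun t : n.+1.-tuple T => (thead t, [tuple of behead t])) @^-1` F k).
  by rewrite -preimage_bigcup -FT preimage_setT.
move=> k; have [mF Fk] := Foo k; split.
  rewrite -[X in measurable X]setTI.
  apply: (measurable_fun_pair _ (@measurable_behead _ _ _)) => //.
  exact: measurable_tnth.
rewrite /cons_leb /pushforward -comp_preimage.
rewrite (_ : _ \o _ = id) ?preimage_id//.
by apply/funext => -[x t] /=; congr (_, _); exact: val_inj.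
Qed.

#[local] HB.instance Definition _ := Measure_isSigmaFinite.Build _ _ _ cons_leb
  cons_leb_sigma_finite.

Definition lebesgue_step :
  {sigma_finite_measure set (n.+1.-tuple T) -> \bar R} := cons_leb.

End step.

Lemma lebesgue_tuple_is_measure n :
  exists mu : {sigma_finite_measure set (n.-tuple T) -> \bar R},
    lebesgue_tuple (n := n) = mu.
Proof.
elim: n => [|n [mu IH]]; first by exists \d_[tuple].
by exists (lebesgue_step mu); rewrite /= IH.
Qed.

Context (n : nat).

Let leb0 : lebesgue_tuple (R := R) (n := n) set0 = 0%E.
Proof. by have [mu ->] := lebesgue_tuple_is_measure n. Qed.

Let leb_ge0 (A : set (n.-tuple T)) : (0 <= lebesgue_tuple A)%E.
Proof. by have [mu ->] := lebesgue_tuple_is_measure n. Qed.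

Let leb_sigma_additive : semi_sigma_additive (lebesgue_tuple (R := R) (n := n)).
Proof.
have [mu ->] := lebesgue_tuple_is_measure n.
exact: measure_semi_sigma_additive.
Qed.

HB.instance Definition _ := isMeasure.Build _ _ _
  (lebesgue_tuple (R := R) (n := n)) leb0 leb_ge0 leb_sigma_additive.

Let leb_sigma_finite : sigma_finite setT (lebesgue_tuple (R := R) (n := n)).
Proof.
by have [mu ->] := lebesgue_tuple_is_measure n; exact: sigma_finiteT.
Qed.

HB.instance Definition _ := Measure_isSigmaFinite.Build _ _ _
  (lebesgue_tuple (R := R) (n := n)) leb_sigma_finite.

End lebesgue_tuple_measure.

Lemma lebesgue_tuple_box (R : realType) (n : nat)
    (B : 'I_n -> set (measurableTypeR R)) :
  (forall i, measurable (B i)) ->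
  lebesgue_tuple [set t | forall i, B i (tnth t i)] =
  (\prod_(i < n) lebesgue_measure (B i))%E.
Proof.
elim: n B => [|n IH] B mB.
  rewrite big_ord0 /= diracE mem_set//; by case.
rewrite big_ord_recl -IH// /= -product_measure1E//=.
  rewrite /pushforward; congr (_ _); apply/seteqP; split => [[x t]/= Bxt|[x t]/= [Bx Bt] i].
    split; first by have := Bxt ord0; rewrite tnth0.
    by move=> i; have := Bxt (lift ord0 i); rewrite tnthS.
  by case: (unliftP ord0 i) => [j ->|->]; rewrite ?tnthS ?tnth0.
rewrite (_ : mkset _ = \bigcap_(i in [set: 'I_n]) ((@tnth n _ ^~ (i)) @^-1` B (lift ord0 i))).
  apply: fin_bigcap_measurable => //= i _; rewrite -[X in measurable X]setTI.
  exact: measurable_tnth.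
by apply/seteqP; split => t /= Bt i; [move=> _|]; exact: Bt.
Qed.

(* fine is harmless on bounded sets, whose measure is finite. *)
Definition volume (R : realType) (n : nat) (A : set 'cV[R]_n) : R :=
  fine (lebesgue_tuple [set t : n.-tuple R | A (\col_i tnth t i)]).

Section convexity.
Context (R : realType) (V : lmodType R).
Implicit Types A P : set V.

Definition conv_hull A : set V := smallest (@convex_set R V) A.

Definition polytope P : Prop :=
  exists2 s : seq V, s != [::] & P = conv_hull [set` s].

Definition affine_set A : Prop :=
  forall (x y : V) (t : R), A x -> A y -> A (t *: x + (1 - t) *: y).

Definition affine_hull A : set V := smallest affine_set A.

End convexity.

(* dim A is the dimension of the linear space of differences of points of the
   affine hull of A; the default value 0 of xget is only used for empty A. *)
Definition direction (R : realType) (V : vectType R) (A : set V) : {vspace V} :=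
  xget 0%VS [set W : {vspace V} |
    [set` W] = [set x - y | x in affine_hull A & y in affine_hull A]].

Section direction_theory.
Context (R : realType) (V : vectType R).
Implicit Types A : set V.

Lemma affine_hull_affine A (x y : V) (t : R) : affine_hull A x -> affine_hull A y ->
  affine_hull A (t *: x + (1 - t) *: y).
Proof.
move=> Ax Ay B BA; apply: (BA.1); [exact: (Ax B BA)|exact: (Ay B BA)].
Qed.

Lemma directionE A : A !=set0 ->
  [set` direction A] = [set x - y | x in affine_hull A & y in affine_hull A].
Proof.
move=> [a Aa]; set D := (RHS).
have Ha : affine_hull A a by move=> B [_ AB]; exact: AB.
have DP v : D v <-> affine_hull A (a + v).
  split => [[x Hx [y Hy <-]]|Hv]; last by exists (a + v) => //; exists a => //; rewrite addrC addKr.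
  have := affine_hull_affine 2 (affine_hull_affine 2^-1 Ha Hx) Hy.
  congr (affine_hull A _); rewrite scalerDr !scalerA mulfV// scale1r.
  rewrite mulrBr mulr1 mulfV// (_ : 2 - 1 = 1) ?scale1r; last by rewrite -addrA subrr addr0.
  by rewrite (_ : 1 - 2 = -1) ?scaleN1r ?addrA// opprD addrA subrr sub0r.
have D0 : D 0 by exists a => //; exists a => //; rewrite subrr.
have DZ k v : D v -> D (k *: v).
  move=> /DP Hv; apply/DP; have := affine_hull_affine k Hv Ha.
  congr (affine_hull A _); rewrite scalerDr scalerBl scale1r.
  by rewrite addrC addrA subrK.
have DD u v : D u -> D v -> D (u + v).
  move=> /DP Hu /DP Hv; rewrite -[u + v]scale1r -(@mulfV _ (2 : R))// -scalerA.
  apply: (DZ); apply/DP; have := affine_hull_affine 2^-1 Hu Hv.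
  congr (affine_hull A _).
  have -> : 1 - 2^-1 = 2^-1 :> R by rewrite {1}(splitr 1) mul1r addrK.
  rewrite -scalerDr (_ : a + u + (a + v) = 2 *: a + (u + v)).
    by rewrite scalerDr scalerA mulVf// scale1r.
  by rewrite addrACA scaler_nat mulr2n.
rewrite /direction; case: xgetP => [W _ //|noW]; exfalso.
pose S := [set W : {vspace V} | [set` W] `<=` D].
have [W [SW Wmax]] : exists W, S W /\ forall W', S W' -> (\dim W' <= \dim W)%N.
  pose P k := `[< exists2 W, S W & \dim W = k >].
  have exP : exists k, P k.
    by exists 0; apply/asboolP; exists 0%VS; [move=> v /=; rewrite memv0 => /eqP ->|rewrite dimv0].
  have Pmax k : P k -> (k <= \dim {:V})%N.
    by move=> /asboolP[W _ <-]; exact/dimvS/subvf.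
  case: (ex_maxnP exP Pmax) => k /asboolP[W SW dW] kmax.
  exists W; split => // W' SW'; rewrite dW; apply: kmax; apply/asboolP; by exists W'.
apply: (noW W); apply/seteqP; split => // v Dv.
have SWv : S (W + <[v]>)%VS.
  by move=> w /= /memv_addP[w1 /SW Dw1 [_ /vlineP[k ->] ->]]; apply: DD => //; exact: DZ.
have := Wmax _ SWv; rewrite (geq_leqif (dimv_leqif_sup (addvSl W <[v]>))) subv_add.
by move=> /andP[_]; rewrite -memvE.
Qed.

End direction_theory.

Definition affdim (R : realType) (V : vectType R) (A : set V) : nat :=
  \dim (direction A).

Definition relint (R : realType) (V : normedModType R) (A : set V) : set V :=
  [set x | affine_hull A x /\ within (affine_hull A) (nbhs x) A].

(* Only meant for convex sets, whose Euler characteristic is 1 unless they are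
   empty. *)
Definition euler_char (R : realType) (V : lmodType R) (P : set V) : R :=
  if P == set0 then 0 else 1.

(* Functionals on a collection S of sets are represented by functions on all
   sets, whose values outside S are irrelevant. *)
Definition valuation (R : realType) (T : Type) (S : set (set T))
    (Psi : set T -> R) : Prop :=
  forall P Q, S P -> S Q -> S (P `&` Q) -> S (P `|` Q) ->
    Psi P + Psi Q = Psi (P `|` Q) + Psi (P `&` Q).

Definition SL_invariant (R : realType) (n : nat) (S : set (set 'cV[R]_n))
    (Psi : set 'cV[R]_n -> R) : Prop :=
  forall (A : 'M[R]_n) (P : set 'cV[R]_n), \det A = 1 -> S P ->
    Psi [set A *m x | x in P] = Psi P.

(* The values of f at negative arguments are irrelevant: f stands for its
   restriction to the nonnegative half-line. *)
Definition cauchy_solution (R : realType) (f : R -> R) : Prop :=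
  forall x y : R, 0 <= x -> 0 <= y -> f (x + y) = f x + f y.

(* Main.v *)
(* Write [0,s] for the hull of 0 and a list s of points, and call "special" the
   hulls of linearly independent lists s and their cones [0,s]. The hull of
   p, q, s is cut by any point z of the segment pq into the hulls of p, z, s and
   z, q, s, which meet exactly in the hull of z, s; so a valuation Psi satisfies
   Psi(p,q,s) + Psi(z,s) = Psi(p,z,s) + Psi(z,q,s).

   Uniqueness. A valuation vanishing on the special simplices vanishes on every
   polytope: as P |-> Psi(hull of v and P) satisfies the same relation, induction
   on the number of vertices reduces the claim to adding one vertex v to a special
   simplex, and cutting edges lowers the number of nonzero coordinates of v.

   Determination on special simplices. SL(n) is transitive on independent k-tuples
   for k < n and on bases of given determinant, so Psi is described there by
   constants and, for k = n, by functions of the determinant, which the cut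
   relation makes additive up to a constant.

   Conversely, the five functionals are invariant valuations. Volume is invariant
   because shears generate SL(n). The relative-interior term is read off
   from the tangent cone at 0: two non-nested closed cones with convex union are
   not linear, and their union is linear iff their intersection is, the dimensions
   then differing by one. For the last term, the join with 0 commutes with unions
   and intersections when the union is convex. *)
Require Import Defs.
From HB Require Import structures.
From mathcomp Require Import all_boot all_order all_algebra.
From mathcomp Require Import all_classical all_reals all_analysis.
From mathcomp Require Import measurable_realfun perm ring lra.

Set Implicit Arguments.
Unset Strict Implicit.
Unset Printing Implicit Defensive.

Import Order.TTheory GRing.Theory Num.Theory.
Import numFieldNormedType.Exports.

Local Open Scope classical_set_scope.
Local Open Scope ring_scope.

Ltac entrywise := apply/matrixP => ? ?; rewrite !mxE.

(** * Convex hulls of finite lists *)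

Section Hull.
Context (R : realType) (n : nat).
Local Notation V := 'cV[R]_n.
Implicit Types (s : seq V) (x y z p q : V) (t u c k : R).

(* Membership of (x, t) in the cone over s placed at height 1, so that
   t = 1 describes the convex hull of s. *)
Fixpoint in_cone s x t : Prop :=
  if s is p :: s' then exists2 c, 0 <= c & in_cone s' (x - c *: p) (t - c)
  else x = 0 /\ t = 0.

Lemma in_cone0 s : in_cone s 0 0.
Proof.
by elim: s => [|p s IH] //=; exists 0 => //; rewrite scale0r !subr0.
Qed.

Lemma in_coneD s x y t u :
  in_cone s x t -> in_cone s y u -> in_cone s (x + y) (t + u).
Proof.
elim: s x y t u => [|p s IH] x y t u /=.
  by move=> [-> ->] [-> ->]; rewrite !addr0.
move=> [c c0 h] [d d0 g]; exists (c + d); first exact: addr_ge0.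
have := IH _ _ _ _ h g; congr (in_cone _ _ _); last by ring.
by entrywise; ring.
Qed.

Lemma in_coneZ s k x t : 0 <= k -> in_cone s x t -> in_cone s (k *: x) (k * t).
Proof.
move=> k0; elim: s x t => [|p s IH] x t /=.
  by move=> [-> ->]; rewrite scaler0 mulr0.
move=> [c c0 h]; exists (k * c); first exact: mulr_ge0.
have := IH _ _ h; congr (in_cone _ _ _); last by ring.
by entrywise; ring.
Qed.

Lemma in_cone_ge0 s x t : in_cone s x t -> 0 <= t.
Proof.
elim: s x t => [|p s IH] x t /=; first by move=> [_ ->].
by move=> [c c0 /IH]; lra.
Qed.

Lemma in_cone_height0 s x : in_cone s x 0 -> x = 0.
Proof.
elim: s x => [|p s IH] x /=; first by case.
move=> [c c0 h]; have c1 : c = 0 by have := in_cone_ge0 h; lra.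
by move: h; rewrite c1 scale0r !subr0 => /IH.
Qed.

Lemma in_cone_behead p s x t : in_cone s x t -> in_cone (p :: s) x t.
Proof. by move=> h; exists 0 => //; rewrite scale0r !subr0. Qed.

Lemma in_cone_mem s p : p \in s -> in_cone s p 1.
Proof.
elim: s => [//|q s IH]; rewrite inE => /orP[/eqP ->|/IH/in_cone_behead//].
by exists 1 => //; rewrite scale1r !subrr; exact: in_cone0.
Qed.

Lemma sub_in_cone s s' x t :
  (forall p, p \in s -> in_cone s' p 1) -> in_cone s x t -> in_cone s' x t.
Proof.
elim: s x t => [|p s IH] x t /=.
  by move=> _ [-> ->]; exact: in_cone0.
move=> h [c c0 g].
have h' q : q \in s -> in_cone s' q 1 by move=> qs; apply: h; rewrite inE qs orbT.
have := in_coneD (IH _ _ h' g) (in_coneZ c0 (h p (mem_head _ _))).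
by rewrite mulr1 !subrK.
Qed.

Lemma convex_setE (A : set V) : convex_set (A : set (convex_lmodType V)) <->
  forall x y t, 0 <= t -> t <= 1 -> A x -> A y -> A (t *: x + (1 - t) *: y).
Proof.
split=> [cA x y t t0 t1 Ax Ay|cA x y l /set_mem Ax /set_mem Ay].
  have h0 : 0 <= t <= 1 by rewrite t0 t1.
  exact: (set_mem (cA x y (Itv01 t0 t1) (mem_set Ax) (mem_set Ay))).
by apply: mem_set; exact: (cA x y l%:num (ge0 l) (le1 l) Ax Ay).
Qed.

Definition hull s : set V := conv_hull [set` s].

Lemma hullE s x : hull s x <-> in_cone s x 1.
Proof.
split.
  move=> /(_ [set y | in_cone s y 1]); apply; split.
    apply/convex_setE => y z t t0 t1 /= hy hz.
    have t2 : 0 <= 1 - t by lra.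
    have := in_coneD (in_coneZ t0 hy) (in_coneZ t2 hz).
    by congr (in_cone _ _ _); ring.
  by move=> y /=; exact: in_cone_mem.
move=> h A [/convex_setE cA sA].
(* Homogenised form of the claim: a conical combination of height [t > 0], rescaled to height 1,
   lies in [A]. Letting [t] vary makes induction on the list possible. *)
suff: forall s x t, {subset s <= A} -> in_cone s x t -> 0 < t -> A (t^-1 *: x).
  move=> /(_ s x 1); rewrite invr1 scale1r; apply => // y ys.
  by rewrite inE; apply: sA.
move=> {sA h x}s x t; elim: s x t => [|p s IH] x t sA /=.
  by move=> [_ ->]; rewrite ltxx.
move=> [c c0 h] t0.
have Ap : A p by have := sA p (mem_head _ _); rewrite inE.
have := in_cone_ge0 h; rewrite le_eqVlt => /orP[/eqP tc|tc].
  move: h; rewrite -tc => /in_cone_height0 /subr0_eq ->.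
  have -> : c = t by lra.
  by rewrite scalerA mulVf ?scale1r// gt_eqF.
have sA' : {subset s <= A} by move=> q qs; apply: sA; rewrite inE qs orbT.
have c1 : 0 <= c / t <= 1.
  by rewrite divr_ge0 ?(ltW t0)//= ler_pdivrMr// mul1r; lra.
have /andP[c2 c3] := c1.
have := cA p _ (c / t) c2 c3 Ap (IH _ _ sA' h tc).
congr A; entrywise; field.
by rewrite !gt_eqF.
Qed.

Lemma hull_mem s p : p \in s -> hull s p.
Proof. by move=> /in_cone_mem/hullE. Qed.

Lemma sub_hull s s' : (forall p, p \in s -> hull s' p) -> hull s `<=` hull s'.
Proof.
move=> h x /hullE hx; apply/hullE; apply: sub_in_cone hx => p /h.
by move=> /hullE.
Qed.

Lemma eq_hull s s' : (forall p, p \in s -> hull s' p) ->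
  (forall p, p \in s' -> hull s p) -> hull s = hull s'.
Proof. by move=> h g; apply/seteqP; split; exact: sub_hull. Qed.

Lemma eq_mem_hull s s' : s =i s' -> hull s = hull s'.
Proof.
by move=> ss'; apply: eq_hull => p; rewrite ?ss' => ?; apply: hull_mem; rewrite ?ss'.
Qed.

Lemma hull_convex s x y t : 0 <= t -> t <= 1 -> hull s x -> hull s y ->
  hull s (t *: x + (1 - t) *: y).
Proof.
move=> t0 t1 /hullE hx /hullE hy; apply/hullE.
have t2 : 0 <= 1 - t by lra.
have := in_coneD (in_coneZ t0 hx) (in_coneZ t2 hy).
by congr (in_cone _ _ _); ring.
Qed.

Lemma hull_nonempty s : s != [::] -> hull s !=set0.
Proof. by case: s => // p s _; exists p; apply: hull_mem; exact: mem_head. Qed.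

Lemma hull_polytope s : s != [::] -> polytope (hull s).
Proof. by exists s. Qed.

(** Compare the weights [a] at [p] and [b] at [q] with the ratio in which [z] divides the edge: one
    of the two points can be absorbed completely into [z], at the expense of the other. *)
Lemma hull_cutU p q s l z : 0 <= l -> l <= 1 -> z = (1 - l) *: p + l *: q ->
  hull [:: p, q & s] = hull [:: p, z & s] `|` hull [:: z, q & s].
Proof.
move=> l0 l1 zE.
have hz : hull [:: p, q & s] z.
  have hp : hull [:: p, q & s] p by apply: hull_mem; exact: mem_head.
  have hq : hull [:: p, q & s] q by apply: hull_mem; rewrite !inE eqxx orbT.
  have l2 : 0 <= 1 - l by lra.
  have l3 : 1 - l <= 1 by lra.
  by rewrite zE; have := hull_convex l2 l3 hp hq; rewrite opprB addrCA subrr addr0.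
apply/seteqP; split; last first.
  by move=> x [|]; apply: sub_hull => y; rewrite !inE => /or3P[/eqP ->|/eqP ->|ys] //;
  apply: hull_mem; rewrite !inE ?eqxx ?ys ?orbT.
move=> x /hullE /= [a a0 [b b0 h]].
have [l00|l00] := eqVneq l 0.
  right; apply/hullE; exists a => //; exists b => //.
  by move: h; rewrite zE l00 subr0 scale1r scale0r addr0.
have [ab|ab] := leP (b * (1 - l)) (a * l).
  left; apply/hullE; exists (a - b * (1 - l) / l).
    by rewrite subr_ge0 ler_pdivrMr // lt_neqAle eq_sym l00.
  exists (b / l); first exact: divr_ge0.
  move: h; congr (in_cone _ _ _); last by field.
  by rewrite zE; entrywise; field.
have l2 : l != 1.
  by apply/eqP => l2; move: ab; rewrite l2 subrr mulr0; nra.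
have l3 : 1 - l != 0 by rewrite subr_eq0 eq_sym.
right; apply/hullE; exists (a / (1 - l)); first by rewrite divr_ge0//; lra.
exists (b - a * l / (1 - l)).
  by rewrite subr_ge0 ler_pdivrMr ?(ltW ab)//; rewrite lt_neqAle eq_sym l3; lra.
move: h; congr (in_cone _ _ _); last by field.
by rewrite zE; entrywise; field.
Qed.

Lemma hull_cutI p q s l z : 0 <= l -> l <= 1 -> z = (1 - l) *: p + l *: q ->
  hull [:: p, z & s] `&` hull [:: z, q & s] = hull (z :: s).
Proof.
move=> l0 l1 zE; apply/seteqP; split; last first.
  by move=> x h; split; move: x h; apply: sub_hull => y;
  rewrite inE => /orP[/eqP ->|ys]; apply: hull_mem; rewrite !inE ?eqxx ?ys ?orbT.
move=> x [/hullE /= [a a0 [b b0 h]] /hullE /= [b' b0' [a' a0' h']]]; apply/hullE.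
have [a00|a00] := eqVneq a 0.
  by exists b => //; move: h; rewrite a00 scale0r !subr0.
have [a00'|a00'] := eqVneq a' 0.
  by exists b' => //; move: h'; rewrite a00' scale0r !subr0.
have d0 : 0 < a * l + a' * (1 - l).
  have : 0 < a by rewrite lt_neqAle eq_sym a00.
  have : 0 < a' by rewrite lt_neqAle eq_sym a00'.
  by nra.
(* The two representations are averaged with the weight [m] for which the masses at [p] and [q] are
   in the ratio [1 - l] to [l], so that together they form a multiple of [z]. *)
pose m := a' * (1 - l) / (a * l + a' * (1 - l)).
have dN0 : a * l + a' * (1 - l) != 0 by rewrite gt_eqF.
have mE : 1 - m = a * l / (a * l + a' * (1 - l)) by rewrite /m; field.
have m0 : 0 <= m by rewrite divr_ge0 ?(ltW d0)// mulr_ge0//; lra.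
have m1 : 0 <= 1 - m by rewrite mE divr_ge0 ?(ltW d0)// mulr_ge0.
exists (m * b + (1 - m) * b' + a * a' / (a * l + a' * (1 - l))).
  apply: addr_ge0; last by rewrite divr_ge0 ?mulr_ge0// ltW.
  by rewrite addr_ge0// mulr_ge0.
have := in_coneD (in_coneZ m0 h) (in_coneZ m1 h').
congr (in_cone _ _ _); last by rewrite mE /m; field.
by rewrite mE /m zE; entrywise; field.
Qed.

End Hull.

(** * Half-space descriptions, closedness and joins with the origin *)

Section Halfspaces.
Context (R : realType) (n : nat).
Local Notation V := 'cV[R]_n.
Implicit Types (s : seq V) (x y z p q v : V) (A B P Q : set V).

(** A pair encodes an affine form, homogenised by the height: [t = 1] gives the affine form and
    [t = 0] its linear part. *)
Definition hval (l : 'rV[R]_n * R) x (t : R) : R := (l.1 *m x) 0 0 + l.2 * t.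

Lemma hvalB l x p t c : hval l (x - c *: p) (t - c) = hval l x t - c * hval l p 1.
Proof.
by rewrite /hval mulmxBr -scalemxAr !mxE; ring.
Qed.

Definition hcomb (a b : R) (l l' : 'rV[R]_n * R) : 'rV[R]_n * R :=
  (a *: l.1 + b *: l'.1, a * l.2 + b * l'.2).

Lemma hval_comb a b l l' x t :
  hval (hcomb a b l l') x t = a * hval l x t + b * hval l' x t.
Proof.
by rewrite /hval/= mulmxDl -!scalemxAl !mxE; ring.
Qed.

Lemma seq_max (a : R) (s : seq R) :
  exists2 c, c \in a :: s & forall b, b \in a :: s -> b <= c.
Proof.
elim: s a => [|b s IH] a.
  by exists a => [|b]; rewrite inE // => /eqP ->.
have [c cs cmax] := IH b; have [ac|ca] := leP a c.
  exists c; first by rewrite inE cs orbT.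
  by move=> d; rewrite inE => /orP[/eqP ->|/cmax].
exists a; first exact: mem_head.
by move=> d; rewrite inE => /orP[/eqP ->//|/cmax dc]; rewrite (le_trans dc)// ltW.
Qed.

(* Fourier-Motzkin elimination of the coefficient of the first generator. *)
Lemma in_cone_halfspaces s : exists L : seq ('rV[R]_n * R),
  forall x t, in_cone s x t <-> forall l, l \in L -> 0 <= hval l x t.
Proof.
elim: s => [|p s [L HL]].
  (* The cone over the empty list is the origin, cut out by both signs of the height and of every
     coordinate. *)
  exists ([:: (0, 1); (0, -1)] ++ [seq (delta_mx 0 i, 0) | i <- enum 'I_n]
          ++ [seq (- delta_mx 0 i, 0) | i <- enum 'I_n]) => x t.
  split=> [[-> ->] l _|H]; first by rewrite /hval mulmx0 mxE mulr0 addr0.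
  split; last first.
    have := H (0, 1) (mem_head _ _); have := H (0, -1).
    rewrite !inE eqxx orbT => /(_ erefl); rewrite /hval/= mul0mx mxE.
    by lra.
  apply/colP => i; rewrite mxE; apply/eqP; rewrite eq_le; apply/andP; split.
    have := H (- delta_mx 0 i, 0); rewrite !mem_cat map_f ?mem_enum// !orbT.
    by move=> /(_ erefl); rewrite /hval/= mul0r addr0 mulNmx -rowE !mxE; lra.
  have := H (delta_mx 0 i, 0); rewrite !mem_cat map_f ?mem_enum// !orbT.
  by move=> /(_ erefl); rewrite /hval/= mul0r addr0 -rowE !mxE.
exists ([seq l <- L | 0 <= hval l p 1] ++
  [seq hcomb (- hval l' p 1) (hval l p 1) l l' |
     l <- [seq l <- L | 0 < hval l p 1], l' <- [seq l <- L | hval l p 1 < 0]]).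
move=> x t; split=> /=.
  move=> [c c0 /HL h] l; rewrite mem_cat => /orP[|/allpairsP[[l1 l2] /=]].
    by rewrite mem_filter => /andP[lp /h]; rewrite hvalB; nra.
  rewrite !mem_filter => -[/andP[l1p /h h1] /andP[l2p /h h2] ->].
  rewrite hval_comb; move: h1 h2; rewrite !hvalB; nra.
move=> H.
(* [c] is the largest of 0 and the lower bounds imposed by the forms negative at [p]; the combined
   forms say that it respects the upper bounds imposed by the forms positive at [p]. *)
have [c clo cmax] := seq_max 0 [seq hval l x t / hval l p 1 | l <- [seq l <- L | hval l p 1 < 0]].
have c0 := cmax _ (mem_head _ _).
exists c => //; apply/HL => l lL; rewrite hvalB.
have [lp|lp|lp] := ltgtP (hval l p 1) 0; last first.
- rewrite lp mulr0 subr0; apply: H; rewrite mem_cat mem_filter lL lp lexx//.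
- move: clo; rewrite inE => /orP[/eqP ->|/mapP[l']].
    rewrite mul0r subr0; apply: H; rewrite mem_cat mem_filter lL ltW//.
  rewrite mem_filter => /andP[l'p l'L] ->.
  have := H (hcomb (- hval l' p 1) (hval l p 1) l l').
  rewrite mem_cat hval_comb
    (@allpairs_f _ _ _ (fun l l' => hcomb (- hval l' p 1) (hval l p 1) l l'))
    ?mem_filter ?lp ?l'p// orbT => /(_ erefl) h.
  have h1 : hval l' x t / hval l' p 1 * hval l p 1 =
    hval l x t - (- hval l' p 1 * hval l x t + hval l p 1 * hval l' x t) / (- hval l' p 1).
    by field; rewrite lt_eqF.
  rewrite h1 opprB addrCA subrr addr0 divr_ge0//; lra.
have : hval l x t / hval l p 1 <= c.
  apply: cmax; rewrite inE; apply/orP; right; apply/mapP; exists l => //.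
  by rewrite mem_filter lp lL.
by rewrite ler_ndivrMr//; lra.
Qed.

Lemma hull_halfspaces s : exists L : seq ('rV[R]_n * R),
  forall x, hull s x <-> forall l, l \in L -> 0 <= hval l x 1.
Proof.
have [L HL] := in_cone_halfspaces s; exists L => x; rewrite hullE; exact: HL.
Qed.

Definition is_convex A : Prop := forall x y (t : R), 0 <= t -> t <= 1 ->
  A x -> A y -> A (t *: x + (1 - t) *: y).

(** A weak form of closedness, with limits along segments only; it can be read off from half-space
    descriptions. *)
Definition segment_closed A : Prop := forall x y,
  (forall t : R, 0 < t -> t <= 1 -> A (t *: y + (1 - t) *: x)) -> A x.

Lemma affine_limit (a b : R) :
  (forall t, 0 < t -> t <= 1 -> 0 <= t * b + (1 - t) * a) -> 0 <= a.
Proof.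
move=> H; rewrite leNgt; apply/negP => a0.
have b0 := H 1 ltr01 (lexx _).
have d0 : 0 < b - a by lra.
(* At this parameter the affine function takes the negative value [a / 2]. *)
have := H (- a / 2 / (b - a)).
rewrite ler_pdivrMr// divr_gt0//; last lra.
have -> : - a / 2 <= 1 * (b - a) by lra.
move=> /(_ erefl erefl).
have -> : - a / 2 / (b - a) * b + (1 - - a / 2 / (b - a)) * a = a / 2.
  by field; rewrite gt_eqF.
by lra.
Qed.

Lemma hval_segment l x y t :
  hval l (t *: y + (1 - t) *: x) 1 = t * hval l y 1 + (1 - t) * hval l x 1.
Proof.
by rewrite /hval mulmxDr -!scalemxAr !mxE; ring.
Qed.

Lemma hull_segment_closed s : segment_closed (hull s).
Proof.
have [L HL] := hull_halfspaces s => x y H; apply/HL => l lL.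
apply: (@affine_limit _ (hval l y 1)) => t t0 t1.
by rewrite -hval_segment; have /HL := H t t0 t1; apply.
Qed.

(** Take the supremum [T] of the parameters with values in [A]. Closedness of [A] puts the point at
    [T] into [A]; beyond [T] the segment runs in [B], whose closedness puts the same point into
    [B]. *)
Lemma segment_crossing A B p q : is_convex A -> segment_closed A ->
  segment_closed B -> A p -> B q ->
  (forall t : R, 0 <= t -> t <= 1 -> A (t *: q + (1 - t) *: p) \/ B (t *: q + (1 - t) *: p)) ->
  exists t : R, [/\ 0 <= t, t <= 1, A (t *: q + (1 - t) *: p) & B (t *: q + (1 - t) *: p)].
Proof.
move=> cA clA clB Ap Bq H.
pose pt t := t *: q + (1 - t) *: p.
pose S := [set t : R | [/\ 0 <= t, t <= 1 & A (pt t)]].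
have S0 : S 0 by split => //; rewrite /pt scale0r add0r subr0 scale1r.
have hS : has_sup S by split; [exists 0|exists 1 => t []].
have ubS := sup_ubound hS.2.
pose T := sup S.
have T0 : 0 <= T by exact: ubS.
have T1 : T <= 1 by apply: sup_le_ub; [exists 0|move=> t []].
have ltT t : 0 <= t -> t < T -> A (pt t).
  move=> t0 /(sup_gt hS.1)[u [u0 u1 Au] tu].
  have uN : u != 0 by rewrite gt_eqF//; lra.
  have k0 : 0 <= t / u by rewrite divr_ge0.
  have k1 : t / u <= 1 by rewrite ler_pdivrMr; lra.
  have := cA _ _ _ k0 k1 Au Ap; congr A.
  by rewrite /pt; entrywise; field.
have AT : A (pt T).
  apply: (clA _ p) => t t0 t1.
  have := ltT ((1 - t) * T); rewrite mulr_ge0//; last lra.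
  move: T0; rewrite le_eqVlt => /orP[/eqP T0|T0].
    move=> _; move: Ap; congr A.
    by rewrite /pt -T0; entrywise; ring.
  have -> : (1 - t) * T < T by nra.
  move=> /(_ erefl erefl); congr A.
  by rewrite /pt; entrywise; ring.
exists T; split => //.
move: T1; rewrite le_eqVlt => /orP[/eqP ->|T1]; first by rewrite subrr scale0r addr0 scale1r.
apply: (clB _ q) => t t0 t1.
have h0 : 0 <= T + t * (1 - T) by nra.
have h1 : T + t * (1 - T) <= 1 by nra.
have [Ah|] := H _ h0 h1.
  have : S (T + t * (1 - T)) by [].
  by move=> /ubS; rewrite -/T => ?; nra.
by congr B; entrywise; ring.
Qed.

Lemma hull_is_convex s : is_convex (hull s).
Proof. by move=> x y t; exact: hull_convex. Qed.

Lemma hull_map (A : 'M[R]_n) s :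
  [set A *m x | x in hull s] = hull (map (mulmx A) s).
Proof.
apply/seteqP; split=> [_ [x /hullE hx <-]|x /hullE hx].
  apply/hullE; move: x (1 : R) hx; elim: s => [|p s IH] x t /=.
    by move=> [-> ->]; rewrite mulmx0.
  move=> [c c0 /IH]; rewrite mulmxBr -scalemxAr => h.
  by exists c.
suff [y hy <-] : exists2 y, in_cone s y 1 & A *m y = x by exists y => //; exact/hullE.
move: x (1 : R) hx; elim: s => [|p s IH] x t /=.
  by move=> [-> ->]; exists 0; rewrite ?mulmx0.
move=> [c c0 /IH[y hy yE]]; exists (y + c *: p); first by exists c => //; rewrite addrK.
by rewrite mulmxDr -scalemxAr yE subrK.
Qed.

(** * Joins of polytopes with the origin *)

Lemma hull_set0U s : s != [::] -> conv_hull ([set 0] `|` hull s) = hull (0 :: s).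
Proof.
move=> s0; apply/seteqP; split=> x.
  move=> /(_ (hull (0 :: s))); apply; split.
    by apply/convex_setE; exact: hull_convex.
  move=> y [->|]; first by apply: hull_mem; exact: mem_head.
  by apply: sub_hull => p ps; apply: hull_mem; rewrite inE ps orbT.
move=> hx A [cA sA]; apply: hx; split => // p /=; rewrite inE => /orP[/eqP ->|ps].
  by apply: sA; left.
by apply: sA; right; exact: hull_mem.
Qed.

Lemma hull_cons0 s x : s != [::] -> hull (0 :: s) x <->
  exists t : R, exists2 p, [/\ 0 <= t, t <= 1 & hull s p] & x = t *: p.
Proof.
move=> s0; split; last first.
  move=> [t [p [t0 t1 /hullE hp] ->]]; apply/hullE.
  exists (1 - t); first lra.
  rewrite scaler0 subr0; have := in_coneZ t0 hp; congr (in_cone _ _ _); ring.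
move=> /hullE [c c0]; rewrite scaler0 subr0 => h.
have := in_cone_ge0 h; rewrite le_eqVlt => /orP[/eqP c1|c1].
  have [p hp] := hull_nonempty s0.
  exists 0, p; first by split => //; lra.
  by move: h; rewrite -c1 scale0r => /in_cone_height0.
have c1N : 1 - c != 0 by rewrite gt_eqF.
exists (1 - c), ((1 - c)^-1 *: x); last by rewrite scalerA mulfV// scale1r.
split; [lra|lra|apply/hullE].
have ci : 0 <= (1 - c)^-1 by rewrite invr_ge0; lra.
by have := in_coneZ ci h; rewrite mulVf.
Qed.

Lemma conv_hull0U P x : polytope P -> conv_hull ([set 0] `|` P) x <->
  exists t : R, exists2 p, [/\ 0 <= t, t <= 1 & P p] & x = t *: p.
Proof.
move=> [s s0 ->]; rewrite -/(hull s) hull_set0U//; exact: hull_cons0.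
Qed.

Lemma polytope0U P : polytope P -> polytope (conv_hull ([set 0] `|` P)).
Proof. by move=> [s s0 ->]; rewrite -/(hull s) hull_set0U//; exact: hull_polytope. Qed.

Lemma polytope_convex P : polytope P -> is_convex P.
Proof. by move=> [s s0 ->]; exact: hull_is_convex. Qed.

Lemma polytope_segment_closed P : polytope P -> segment_closed P.
Proof. by move=> [s s0 ->]; exact: hull_segment_closed. Qed.

Lemma polytope_nonempty P : polytope P -> P !=set0.
Proof. by move=> [s s0 ->]; exact: hull_nonempty. Qed.

(** The join is the union of the segments from 0 to the points of the polytope, a description that
    commutes with unions. *)
Lemma conv_hull0U_setU P Q : polytope P -> polytope Q -> polytope (P `|` Q) ->
  conv_hull ([set 0] `|` (P `|` Q)) =
  conv_hull ([set 0] `|` P) `|` conv_hull ([set 0] `|` Q).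
Proof.
move=> pP pQ pPQ; apply/seteqP; split=> x.
  move=> /(conv_hull0U _ pPQ)[t [p [t0 t1 [Pp|Qp]] ->]]; [left|right];
  by apply/conv_hull0U => //; exists t, p.
by move=> [/(conv_hull0U _ pP)|/(conv_hull0U _ pQ)] [t [p [t0 t1 Pp] ->]];
  apply/conv_hull0U => //; exists t, p => //; split => //; [left|right].
Qed.

(* Points p of P and q of Q on a common ray from 0 bound a segment in the convex
   set P `|` Q, which meets P `&` Q. *)
Lemma conv_hull0U_setI P Q : polytope P -> polytope Q -> polytope (P `|` Q) ->
  polytope (P `&` Q) ->
  conv_hull ([set 0] `|` (P `&` Q)) =
  conv_hull ([set 0] `|` P) `&` conv_hull ([set 0] `|` Q).
Proof.
move=> pP pQ pU pI; apply/seteqP; split=> x.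
  by move=> /(conv_hull0U _ pI)[t [p [t0 t1 [Pp Qp]] ->]]; split;
    apply/conv_hull0U => //; exists t, p.
move=> [/(conv_hull0U _ pP)[t [p [t0 t1 Pp] xp]] /(conv_hull0U _ pQ)[u [q [u0 u1 Qq] xq]]].
apply/conv_hull0U => //.
have [z [Pz Qz]] := polytope_nonempty pI.
have [x0|x0] := eqVneq x 0.
  by exists 0, z => //; rewrite scale0r.
have tN : t != 0 by apply: contraNneq x0 => t00; rewrite xp t00 scale0r.
have uN : u != 0 by apply: contraNneq x0 => u00; rewrite xq u00 scale0r.
have [|k [k0 k1 Pk Qk]] := segment_crossing (polytope_convex pP) (polytope_segment_closed pP)
  (polytope_segment_closed pQ) Pp Qq.
  move=> k k0 k1; have := polytope_convex pU k0 k1 (or_intror Qq) (or_introl Pp).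
  by [].
have pE : p = t^-1 *: x by rewrite xp scalerA mulVf// scale1r.
have qE : q = u^-1 *: x by rewrite xq scalerA mulVf// scale1r.
have ti : 1 <= t^-1 by rewrite invf_ge1// lt_neqAle eq_sym tN.
have ui : 1 <= u^-1 by rewrite invf_ge1// lt_neqAle eq_sym uN.
(* The crossing point is [m *: x], where [m >= 1] is an average of [t^-1] and [u^-1]; hence [x] lies
   between 0 and a point of the intersection. *)
pose m := k * u^-1 + (1 - k) * t^-1.
have m1 : 1 <= m by rewrite /m; nra.
have zE : k *: q + (1 - k) *: p = m *: x by rewrite pE qE /m; entrywise; ring.
exists m^-1, (k *: q + (1 - k) *: p).
  by split => //; [rewrite invr_ge0; lra|rewrite invf_le1//; lra].
by rewrite zE scalerA mulVf ?scale1r// gt_eqF//; lra.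
Qed.

End Halfspaces.

(** * Functions of finite point lists with the cut property *)

Section CutFunctions.
Context (R : realType) (n : nat).
Local Notation V := 'cV[R]_n.
Implicit Types (s X : seq V) (x y z p q v w u : V) (F : seq V -> R).
Implicit Types (L : seq (R * V)).

Definition cut_function F : Prop :=
  (forall s s', hull s = hull s' -> F s = F s') /\
  (forall p q s l z, 0 <= l -> l <= 1 -> z = (1 - l) *: p + l *: q ->
    F [:: p, q & s] + F (z :: s) = F [:: p, z & s] + F [:: z, q & s]).

(** The second clause includes the empty [X], that is, the point 0. *)
Definition vanishes_on_special F : Prop :=
  (forall X, free X -> X != [::] -> F X = 0) /\
  (forall X, free X -> F (0 :: X) = 0).

Definition lincomb L : V := \sum_(i <- L) i.1 *: i.2.

Definition nnz L : nat := count (fun i => i.1 != 0) L.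

Lemma lincomb_cons c w L : lincomb ((c, w) :: L) = c *: w + lincomb L.
Proof. by rewrite /lincomb big_cons. Qed.

Lemma lincomb_span L : lincomb L \in <<unzip2 L>>%VS.
Proof.
elim: L => [|[c w] L IH]; first by rewrite /lincomb big_nil mem0v.
rewrite lincomb_cons /= span_cons; apply: memv_add IH.
by apply: rpredZ; exact: memv_line.
Qed.

Lemma free_head_comb c w v X : free (w :: X) -> c != 0 -> v \in <<X>>%VS ->
  free (c *: w + v :: X).
Proof.
rewrite !free_cons => /andP[wX fX] c0 vX; rewrite fX andbT.
apply: contra wX => h.
have : c *: w \in <<X>>%VS by rewrite -[c *: w](addrK v) rpredB.
by move=> /(rpredZ c^-1); rewrite scalerA mulVf// scale1r.
Qed.

Definition rescale k L : seq (R * V) := [seq (k * i.1, i.2) | i <- L].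

Lemma lincomb_rescale k L : lincomb (rescale k L) = k *: lincomb L.
Proof.
rewrite /lincomb big_map scaler_sumr; apply: eq_bigr => i _.
by rewrite scalerA.
Qed.

Lemma unzip2_rescale k L : unzip2 (rescale k L) = unzip2 L.
Proof. by rewrite /unzip2 -map_comp. Qed.

Lemma nnz_rescale k L : k != 0 -> nnz (rescale k L) = nnz L.
Proof.
move=> k0; rewrite /nnz count_map; apply: eq_count => i /=.
by rewrite mulf_eq0 negb_or k0.
Qed.

Section Vanishing.
Variables (F : seq V -> R) (cutF : cut_function F) (F0 : vanishes_on_special F).

Let Fmem s s' : s =i s' -> F s = F s'.
Proof. by move=> ss'; apply: cutF.1; exact: eq_mem_hull. Qed.

(** With [O] empty or [[:: 0]], simplices without and with the vertex 0 are treated by one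
    argument. *)
Variable O : seq V.
Hypothesis O0 : O = [::] \/ O = [:: 0].

Let F_special X : free X -> X != [::] -> F (X ++ O) = 0.
Proof.
case: O0 => -> fX X0; first by rewrite cats0; exact: F0.1.
by rewrite (@Fmem _ (0 :: X)) ?F0.2// => x; rewrite mem_cat !inE orbC.
Qed.

Let F_special0 X : free X -> F (0 :: X ++ O) = 0.
Proof.
move=> fX; rewrite -(F0.2 X fX); apply: Fmem => x.
by case: O0 => ->; rewrite ?cats0// !(inE, mem_cat); case: (x == 0); rewrite ?orbF.
Qed.

(** Of [w] and [c *: w], the one nearer to 0 cuts the edge from 0 to the other; all remaining terms
    of the cut relation are special simplices. *)
Let F_dep_one c w X : free (w :: X) -> 0 < c -> F (c *: w :: (w :: X) ++ O) = 0.
Proof.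
move=> fwX c0.
have fcX : free (c *: w :: X).
  have := free_head_comb fwX (lt0r_neq0 c0) (mem0v _).
  by rewrite addr0.
have fw0 := F_special0 fwX; have fc0 := F_special0 fcX.
have fw := F_special fwX isT; have fc := F_special fcX isT.
have [c1|c1] := leP c 1.
  have := cutF.2 0 w (X ++ O) c (c *: w) (ltW c0) c1.
  rewrite scaler0 add0r => /(_ erefl).
  by move: fw0 fc0 fc => /= -> -> ->; rewrite !add0r => <-.
have := cutF.2 0 (c *: w) (X ++ O) c^-1 w.
rewrite invr_ge0 (ltW c0) invf_le1// (ltW c1) scaler0 add0r scalerA mulVf ?gt_eqF//.
rewrite scale1r => /(_ erefl erefl erefl).
move: fw0 fc0 fw => /= -> -> ->; rewrite !add0r => ->.
by apply: Fmem => x; rewrite !(inE, mem_cat) orbCA.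
Qed.

(** Induction on the number of nonzero coefficients: one coefficient is negative, or two are
    positive, or the vector is a nonnegative multiple of a single member of the list, or 0. *)
Lemma cut_function_dep L : free (unzip2 L) -> F (lincomb L :: unzip2 L ++ O) = 0.
Proof.
move: {2}(nnz L).+1 (ltnSn (nnz L)) => m.
elim: m L => [//|m IH] L; rewrite ltnS => Lm fL.
have perm L' : perm_eq L L' ->
    [/\ F (lincomb L :: unzip2 L ++ O) = F (lincomb L' :: unzip2 L' ++ O),
       free (unzip2 L') & (nnz L' <= m)%N].
  move=> LL'; have p2 : perm_eq (unzip2 L) (unzip2 L') by exact: perm_map.
  split; last 2 first.
  - by rewrite -(perm_free p2).
  - by move/seq.permP: LL' => LL'; rewrite /nnz -LL'.
  rewrite {1}/lincomb (perm_big _ LL'); apply: Fmem => x.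
  by rewrite !(inE, mem_cat) (perm_mem p2).
have [/hasP[[c w] cL /= c0]|noneg] := boolP (has (fun i => i.1 < 0) L).
  set L' := rem (c, w) L.
  have [-> /= fwL nL] := perm _ (perm_to_rem cL).
  have {}nL : (nnz L' < m)%N by move: nL; rewrite /nnz /= ltr0_neq0.
  have fvL : free (c *: w + lincomb L' :: unzip2 L').
    by apply: free_head_comb => //; [rewrite ltr0_neq0|exact: lincomb_span].
  rewrite lincomb_cons.
  set v := c *: w + _ in fvL *.
  (* As [c < 0], the edge from [v] to [w] contains [k *: lincomb L'], which does not involve [w].
     Over [L'], [v :: L'] and [w :: L'] this point has fewer nonzero coefficients than the original
     vector. *)
  have c1 : 1 - c != 0 by rewrite gt_eqF//; lra.
  pose k := (1 - c)^-1.
  have k0 : k != 0 by rewrite invr_eq0.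
  have l0 : 0 <= - c / (1 - c) by rewrite divr_ge0//; lra.
  have l1 : - c / (1 - c) <= 1 by rewrite ler_pdivrMr; lra.
  have zE : k *: lincomb L' = (1 - - c / (1 - c)) *: v + (- c / (1 - c)) *: w.
    by rewrite /v /k; entrywise; field.
  have := cutF.2 v w (unzip2 L' ++ O) _ _ l0 l1 zE.
  have h w' : free (w' :: unzip2 L') -> F (k *: lincomb L' :: w' :: unzip2 L' ++ O) = 0.
    move=> fw; have := IH ((0, w') :: rescale k L').
    rewrite lincomb_cons scale0r add0r lincomb_rescale /= unzip2_rescale.
    by rewrite /nnz/= eqxx -/(nnz _) nnz_rescale//; exact.
  rewrite h//.
  rewrite [F [:: v, k *: _ & _]](@Fmem _ (k *: lincomb L' :: v :: unzip2 L' ++ O)).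
    rewrite h//.
    have := IH (rescale k L').
    rewrite lincomb_rescale unzip2_rescale nnz_rescale// => ->//.
      by rewrite !addr0.
    by move: fwL; rewrite free_cons => /andP[].
  by move=> x; rewrite !inE orbCA.
have ge0 c w : (c, w) \in L -> 0 <= c.
  by move=> cL; move/hasPn: noneg => /(_ _ cL) /=; rewrite -leNgt.
have [/hasP[[c w] cL /= c0]|nopos] := boolP (has (fun i => 0 < i.1) L); last first.
  have -> : lincomb L = 0.
    rewrite /lincomb big_seq big1// => -[c w] cL.
    have : c <= 0 by move/hasPn: nopos => /(_ _ cL) /=; rewrite -leNgt.
    by have := ge0 _ _ cL => /= ? ?; rewrite (_ : c = 0) ?scale0r//; lra.
  exact: F_special0.
set L1 := rem (c, w) L.
have LL1 := perm_to_rem cL.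
have sL1 i : i \in L1 -> i \in L by exact: mem_rem.
have [/hasP[[d u] dL /= d0]|nopos] := boolP (has (fun i => 0 < i.1) L1); last first.
  have [-> /= fwL nL] := perm _ LL1.
  rewrite lincomb_cons (_ : lincomb _ = 0) ?addr0; first exact: F_dep_one.
  rewrite /lincomb big_seq big1// => -[d u] dL.
  have : d <= 0 by move/hasPn: nopos => /(_ _ dL) /=; rewrite -leNgt.
  by have := ge0 _ _ (sL1 _ dL) => /= ? ?; rewrite (_ : d = 0) ?scale0r//; lra.
set L2 := rem (d, u) L1.
have LL2 : perm_eq L [:: (c, w), (d, u) & L2].
  by apply: (perm_trans LL1); rewrite perm_cons; exact: perm_to_rem.
have [-> /= fwL nL] := perm _ LL2.
have {}nL : ((nnz L2).+1 < m)%N by move: nL; rewrite /nnz/= !gt_eqF.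
have cd0 : c + d != 0 by rewrite gt_eqF//; lra.
(* Two positive coefficients are merged: [z] is the point of the edge from [w] to [u] in the
   direction of [c *: w + d *: u], so exchanging [w] or [u] for [z] leaves one nonzero coefficient
   fewer. *)
pose z := (c + d)^-1 *: (c *: w + d *: u).
have l0 : 0 <= d / (c + d) by rewrite divr_ge0//; lra.
have l1 : d / (c + d) <= 1 by rewrite ler_pdivrMr; lra.
have zE : z = (1 - d / (c + d)) *: w + (d / (c + d)) *: u.
  by rewrite /z; entrywise; field.
rewrite !lincomb_cons; set v := (X in F (X :: _)).
have vE : v = lincomb ((c + d, z) :: L2).
  rewrite /v lincomb_cons; rewrite /z scalerA mulfV// scale1r addrA.
  by [].
have fuwL : free [:: u, w & unzip2 L2].
  by move: fwL; rewrite (@perm_free _ _ _ [:: u, w & unzip2 L2])//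
    -[X in perm_eq X _]/([:: w] ++ [:: u] ++ unzip2 L2) perm_catCA.
have fuL : free (u :: unzip2 L2) by move: fwL; rewrite free_cons => /andP[].
have cN : c / (c + d) != 0 by rewrite mulf_neq0 ?invr_eq0// gt_eqF.
have dN : d / (c + d) != 0 by rewrite mulf_neq0 ?invr_eq0// gt_eqF.
have fzw : free [:: z, w & unzip2 L2].
  rewrite zE addrC; apply: free_head_comb => //.
  by apply: rpredZ; apply: memv_span; exact: mem_head.
have fzu : free [:: z, u & unzip2 L2].
  rewrite zE (_ : 1 - d / (c + d) = c / (c + d)); last by field.
  apply: free_head_comb => //.
  by apply: rpredZ; apply: memv_span; exact: mem_head.
have fz : free (z :: unzip2 L2).
  move: fzw; rewrite !free_cons span_cons => /and3P[zw _ ->]; rewrite andbT.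
  by apply: contra zw => zL; rewrite -[z]add0r memv_add// mem0v.
have Fz : F (v :: z :: unzip2 L2 ++ O) = 0.
  have := IH ((c + d, z) :: L2); rewrite -vE /= /nnz/= cd0 -/(nnz _).
  by apply.
have Fzw w' : free [:: z, w' & unzip2 L2] -> F (v :: z :: w' :: unzip2 L2 ++ O) = 0.
  move=> fzw'; have := IH ((c + d, z) :: (0, w') :: L2).
  rewrite lincomb_cons lincomb_cons scale0r add0r -lincomb_cons -vE /= /nnz/= cd0 eqxx.
  by rewrite -/(nnz _); apply.
have := cutF.2 w u (v :: unzip2 L2 ++ O) _ _ l0 l1 zE.
rewrite [F [:: z, v & _]](@Fmem _ (v :: z :: unzip2 L2 ++ O)); last first.
  by move=> x; rewrite !inE orbCA.
rewrite Fz [F [:: w, z, v & _]](@Fmem _ (v :: z :: w :: unzip2 L2 ++ O)); last first.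
  by move=> x; rewrite !inE; case: (x == w); case: (x == z); case: (x == v).
rewrite Fzw// [F [:: z, u, v & _]](@Fmem _ (v :: z :: u :: unzip2 L2 ++ O)); last first.
  by move=> x; rewrite !inE; case: (x == u); case: (x == z); case: (x == v).
rewrite Fzw// !addr0 => <-.
by apply: Fmem => x; rewrite !inE; case: (x == u); case: (x == w); case: (x == v).
Qed.

Lemma cut_function_cons v X : free X -> F (v :: X ++ O) = 0.
Proof.
move=> fX; have [vX|vX] := boolP (v \in <<X>>%VS); last first.
  by rewrite -cat_cons F_special// free_cons vX.
pose L := [seq (coord (in_tuple X) i v, X`_i) | i <- enum 'I_(size X)].
have XL : unzip2 L = X.
  rewrite /unzip2 -map_comp; apply: (@eq_from_nth _ 0); rewrite size_map size_enum_ord//.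
  move=> i iX; rewrite (nth_map (Ordinal iX)) ?size_enum_ord//=.
  by rewrite nth_enum_ord.
have vL : lincomb L = v.
  rewrite [RHS](coord_span (X := in_tuple X) vX) /lincomb big_map big_enum.
  by [].
by have := @cut_function_dep L; rewrite XL vL; apply.
Qed.

End Vanishing.

(** The fixed vertex [v] joins the tail, over which the cut relation is quantified. *)
Lemma cut_function_push F v : cut_function F -> cut_function (fun s => F (v :: s)).
Proof.
move=> [Fh Fc]; split=> [s s' ss'|p q s l z l0 l1 zE].
  apply: Fh; apply: eq_hull => p; rewrite inE => /orP[/eqP ->|ps].
  - by apply: hull_mem; exact: mem_head.
  - move: (hull_mem ps); rewrite ss'; apply: sub_hull => y ys.
    by apply: hull_mem; rewrite inE ys orbT.
  - by apply: hull_mem; exact: mem_head.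
  - move: (hull_mem ps); rewrite -ss'; apply: sub_hull => y ys.
    by apply: hull_mem; rewrite inE ys orbT.
have Fmem s1 s2 : s1 =i s2 -> F s1 = F s2.
  by move=> ss'; apply: Fh; exact: eq_mem_hull.
have := Fc p q (v :: s) l z l0 l1 zE.
rewrite (@Fmem [:: z, v & s] [:: v, z & s]); last by move=> x; rewrite !inE orbCA.
congr (_ + _ = _ + _); apply: Fmem => x; rewrite !inE.
- by case: (x == p); case: (x == q); case: (x == v).
- by case: (x == p); case: (x == z); case: (x == v).
- by case: (x == z); case: (x == q); case: (x == v).
Qed.

Lemma cut_function_eq0 F s : cut_function F -> vanishes_on_special F ->
  s != [::] -> F s = 0.
Proof.
elim: s F => [//|v s IH] F cutF F0 _; have [-> {IH}|s0] := eqVneq s [::].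
  have [->|v0] := eqVneq v 0; first by rewrite F0.2// nil_free.
  by rewrite F0.1// seq1_free.
apply: (IH (fun s => F (v :: s))) => //; first exact: cut_function_push.
split=> X fX.
  move=> _; have := cut_function_cons cutF F0 (or_introl erefl) v fX.
  by rewrite cats0.
have := cut_function_cons cutF F0 (or_intror erefl) v fX => <-.
by apply: cutF.1; apply: eq_mem_hull => x; rewrite !(inE, mem_cat); congr (_ || _); exact: orbC.
Qed.

End CutFunctions.

(** * Orbits of SL(n) on linearly independent lists *)

Section SLOrbits.
Context (R : realType) (n : nat).
Local Notation V := 'cV[R]_n.
Implicit Types (s X Y : seq V) (x y z p q v w u : V) (F : seq V -> R).

(** The vectors are the rows, so applying [A] to the list multiplies this matrix on the right by the
    transpose of [A]. *)
Definition list_mx X : 'M[R]_n := \matrix_(i, j) (X`_i) j 0.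

Definition list_det X : R := \det (list_mx X).

Lemma list_det_neq0 X : free X -> size X = n -> list_det X != 0.
Proof.
move=> fX sX; apply/negP => /det0P[u u0 uX].
have /freeP/(_ (fun i => u 0 (cast_ord sX i))) : free (in_tuple X) by [].
move=> H; move/eqP: u0; apply; apply/rowP => i; rewrite mxE.
rewrite -(H _ (cast_ord (esym sX) i)); first by congr (u 0 _); exact: val_inj.
apply/colP => j; rewrite summxE; transitivity ((u *m list_mx X) 0 j); last by rewrite uX !mxE.
rewrite [RHS]mxE [RHS](reindex (cast_ord sX))/=; last first.
  by exists (cast_ord (esym sX)) => k _; exact: val_inj.
by apply: eq_bigr => k _; rewrite !mxE.
Qed.

Lemma list_det_comb a b p q s : (0 < n)%N ->
  list_det (a *: p + b *: q :: s) = a * list_det (p :: s) + b * list_det (q :: s).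
Proof.
move=> n0; apply: (determinant_multilinear (i0 := Ordinal n0)).
- by apply/rowP => j; rewrite !mxE.
- by apply/matrixP => i j; rewrite !mxE.
- by apply/matrixP => i j; rewrite !mxE.
Qed.

Lemma list_detZ a p s : (0 < n)%N -> list_det (a *: p :: s) = a * list_det (p :: s).
Proof.
by move=> n0; have := list_det_comb a 0 p 0 s n0; rewrite scale0r addr0 mul0r addr0.
Qed.

Lemma list_det_swap p q s : (1 < n)%N -> list_det [:: p, q & s] = - list_det [:: q, p & s].
Proof.
move=> n1; pose i0 := Ordinal (ltnW n1); pose i1 := Ordinal n1.
have -> : list_det [:: p, q & s] = \det (row_perm (tperm i0 i1) (list_mx [:: q, p & s])).
  congr (\det _); apply/matrixP => i j; rewrite !mxE.
  case: tpermP => [->|->|/eqP + /eqP +] //=.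
  by rewrite -!val_eqE /=; case: (nat_of_ord i) => [|[|k]].
by rewrite row_permE det_mulmx det_perm odd_tperm /= expr1 mulN1r.
Qed.

Lemma list_det_dup p s : (1 < n)%N -> list_det [:: p, p & s] = 0.
Proof. by move=> n1; have := list_det_swap p p s n1; lra. Qed.

Lemma list_det_comb1 a b p q s : (1 < n)%N ->
  list_det [:: p, a *: p + b *: q & s] = b * list_det [:: p, q & s].
Proof.
move=> n1; have n0 := ltnW n1.
rewrite (list_det_swap p (_ + _))// list_det_comb// list_det_dup// mulr0 add0r.
by rewrite (list_det_swap q)// mulrN opprK.
Qed.

Lemma free_size X : free X -> (size X <= n)%N.
Proof.
move=> /eqP <-; apply: leq_trans (dimvS (subvf _)) _.
by rewrite dimvf dim_matrix; exact: (eq_leq (muln1 n)).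
Qed.

Lemma free_extend X : free X -> exists Y, free (Y ++ X) /\ size (Y ++ X) = n.
Proof.
move=> fX; exists (vbasis (<<X>>^C)%VS).
have bX : basis_of <<X>> X by rewrite /basis_of eqxx.
have dX : directv (<<X>>^C + <<X>>).
  by rewrite directv_addE /= !directv_trivial capvC capv_compl eqxx.
have b := cat_basis dX (vbasisP _) bX; split; first exact: basis_free b.
have := @size_basis _ _ _ _ (in_tuple (vbasis (<<X>>^C)%VS ++ X)) b.
by rewrite addvC addv_complf dimvf dim_matrix => <-; exact: muln1.
Qed.

Lemma SL_transport_basis X Y : free X -> size X = n -> free Y -> size Y = n ->
  list_det X = list_det Y -> exists A : 'M[R]_n, \det A = 1 /\ map (mulmx A) X = Y.
Proof.
move=> fX sX fY sY dXY; have dX := list_det_neq0 fX sX.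
have uX : list_mx X \in unitmx by rewrite unitmxE unitfE.
exists ((invmx (list_mx X) *m list_mx Y)^T); split.
  by rewrite det_tr det_mulmx det_inv -/(list_det X) -/(list_det Y) -dXY mulVf.
apply: (@eq_from_nth _ 0); first by rewrite size_map sX sY.
move=> i; rewrite size_map => iX; rewrite (nth_map 0)//.
have in_ : (i < n)%N by rewrite -sX.
have rowE Z : row (Ordinal in_) (list_mx Z) = (Z`_i)^T by apply/rowP => j; rewrite !mxE.
apply: trmx_inj; rewrite trmx_mul trmxK -rowE -row_mul mulmxA mulmxV// mul1mx.
exact: rowE.
Qed.

Lemma SL_transport X Y : free X -> free Y -> size X = size Y ->
  (size X = n -> list_det X = list_det Y) ->
  exists A : 'M[R]_n, \det A = 1 /\ map (mulmx A) X = Y.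
Proof.
move=> fX fY sXY dXY.
have [sX|sX] := eqVneq (size X) n; first by apply: SL_transport_basis; rewrite -?sXY//; exact: dXY.
have [X' [fX' sX']] := free_extend fX; have [Y' [fY' sY']] := free_extend fY.
have ss : size X' = size Y' by apply/eqP; rewrite -(eqn_add2r (size X)) {2}sXY -!size_cat sX' sY'.
have X'0 : (0 < size X')%N.
  rewrite lt0n; apply/eqP => X'0; move/eqP: sX; apply.
  by move: sX'; rewrite size_cat X'0.
have n0 : (0 < n)%N by rewrite -sX' size_cat ltn_addr.
case: X' fX' sX' ss X'0 => [//|x X'] fX' sX' ss _.
case: Y' ss fY' sY' => [//|y Y'] ss fY' sY'.
have dX := list_det_neq0 fX' sX'; have dY := list_det_neq0 fY' sY'.
(* Below full size both lists have been extended to bases; scaling one added vector by [c] equalises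
   the determinants and leaves [X] unchanged. *)
pose c := list_det ((y :: Y') ++ Y) / list_det ((x :: X') ++ X).
have fcX : free ((c *: x :: X') ++ X).
  rewrite cat_cons -[c *: x]addr0; apply: free_head_comb (mem0v _) => //.
  by rewrite mulf_neq0// invr_eq0.
have [] := SL_transport_basis fcX _ fY' sY'.
- by move: sX'; rewrite !size_cat.
- by rewrite cat_cons list_detZ// /c divfK.
move=> A [dA]; rewrite map_cat => /eqP; rewrite eqseq_cat; last by rewrite size_map.
by move=> /andP[_ /eqP]; exists A.
Qed.

(** * Values of SL(n) invariant cut functions on simplices *)

Section Constants.
Hypothesis n2 : (1 < n)%N.
Variables (F : seq V -> R) (cutF : cut_function F).
Hypothesis SLF : forall (A : 'M[R]_n) s, \det A = 1 -> s != [::] ->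
  F (map (mulmx A) s) = F s.
Variable O : seq V.
Hypothesis O0 : O = [::] \/ O = [:: 0].

Let F_orbit X Y : free X -> free Y -> size X = size Y -> X != [::] ->
  (size X = n -> list_det X = list_det Y) -> F (X ++ O) = F (Y ++ O).
Proof.
move=> fX fY sXY X0 dXY; have [A [dA <-]] := SL_transport fX fY sXY dXY.
rewrite -(SLF dA); last by case: X X0 {fX sXY dXY}.
by rewrite map_cat; congr (F (_ ++ _)); case: O0 => -> //=; rewrite mulmx0.
Qed.

Let mid_cut l p q X : 0 < l -> l < 1 -> free [:: p, q & X] ->
  let z := (1 - l) *: p + l *: q in
  [/\ F ([:: p, q & X] ++ O) + F ((z :: X) ++ O) =
       F ([:: p, z & X] ++ O) + F ([:: z, q & X] ++ O),
      free (z :: X), free [:: p, z & X] & free [:: z, q & X]].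
Proof.
move=> l0 l1 fpq z.
have fqp : free [:: q, p & X].
  by rewrite (@perm_free _ _ _ [:: p, q & X])// -[X in perm_eq X _]/([:: q] ++ [:: p] ++ X)
    perm_catCA.
have l1N : 1 - l != 0 by rewrite gt_eqF//; lra.
have lN : l != 0 by rewrite gt_eqF.
have fzq : free [:: z, q & X].
  apply: free_head_comb => //.
  by apply: rpredZ; apply: memv_span; exact: mem_head.
have fzp : free [:: z, p & X].
  rewrite /z addrC; apply: free_head_comb => //.
  by apply: rpredZ; apply: memv_span; exact: mem_head.
split => //.
- by apply: cutF.2 (erefl _); rewrite ltW.
- move: fzp; rewrite !free_cons span_cons => /and3P[zw _ ->]; rewrite andbT.
  by apply: contra zw => zL; rewrite -[z]add0r memv_add// mem0v.
- by rewrite (@perm_free _ _ _ [:: z, p & X])// -[X in perm_eq X _]/([:: p] ++ [:: z] ++ X)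
    perm_catCA.
Qed.

(** Below full size, the list and the two lists obtained by cutting an edge at its midpoint are in
    one orbit. The cut relation then equates their common value with the value on one vector
    fewer. *)
Lemma cut_constant_low X v : free X -> (0 < size X < n)%N -> v != 0 ->
  F (X ++ O) = F (v :: O).
Proof.
elim: X => [//|p X IH] fX /= sX v0.
case: X => [|q X] in IH fX sX *.
  apply: (@F_orbit [:: p] [:: v]) => //; first by rewrite seq1_free.
  by move=> /= n1; exfalso; move: n2; rewrite -n1.
have h0 : 0 < 2^-1 :> R by lra.
have h1 : 2^-1 < 1 :> R by lra.
have [] := mid_cut h0 h1 fX; set z : V := _ + _ => H fz fpz fzq.
have nn : size [:: p, q & X] <> n by apply/eqP; rewrite ltn_eqF.
have E1 := @F_orbit _ _ fX fpz erefl isT (fun e => False_ind _ (nn e)).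
have E2 := @F_orbit _ _ fX fzq erefl isT (fun e => False_ind _ (nn e)).
have -> : F ([:: p, q & X] ++ O) = F ((z :: X) ++ O) by move: E1 E2 H; lra.
have fqX : free (q :: X) by move: fX; rewrite free_cons => /andP[].
have sX' : (size (q :: X) < n)%N by rewrite ltnW.
have nn' : size (q :: X) <> n by apply/eqP; rewrite ltn_eqF.
rewrite -(IH fqX)//.
by apply: F_orbit => //= e; case: nn'; rewrite -e.
Qed.

(** Orbits of bases are classified by the determinant. Cutting an edge splits the determinant
    additively, and the common face, with [n - 1] independent vectors, contributes a constant. *)
Lemma cut_cauchy_top : exists f : R -> R, [/\ cauchy_solution f, f 0 = 0 &
  forall X v, free X -> size X = n -> v != 0 ->
    F (X ++ O) = F (v :: O) + f `|list_det X| ].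
Proof.
have [E [fE]] := free_extend (nil_free _); rewrite cats0 => sE.
have fE' : free E by rewrite -[E]cats0.
have dE := list_det_neq0 fE' sE.
case: E sE fE' {fE} dE => [|e E] /= sE fE dE; first by exfalso; move: n2; rewrite -sE.
have n0 : (0 < n)%N by rewrite ltnW.
(* For [d != 0] this represents the orbit of bases of determinant [d]. *)
pose D d := d / list_det (e :: E) *: e :: E.
have dD d : list_det (D d) = d by rewrite /D list_detZ// divfK.
have sD d : size (D d) = n by rewrite /= sE.
have fD d : d != 0 -> free (D d).
  move=> d0; rewrite /D -[_ *: e]addr0; apply: free_head_comb (mem0v _) => //.
  by rewrite mulf_neq0// invr_eq0.
(* [D 0] is not a basis; the default 0 is the value that additivity forces at 0. *)
pose f d := if 0 < d then F (D d ++ O) - F (e :: O) else 0.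
have e0 : e != 0 by move: fE; apply: contraTneq => ->; rewrite free_cons mem0v.
have Fv v : v != 0 -> F (v :: O) = F (e :: O).
  move=> v0; apply: (@F_orbit [:: v] [:: e]) => //; [by rewrite seq1_free..|].
  by move=> /= n1; exfalso; move: n2; rewrite -n1.
have topE X : free X -> size X = n -> F (X ++ O) = F (e :: O) + f `|list_det X|.
  move=> fX sX; have dX := list_det_neq0 fX sX.
  rewrite /f normr_gt0 dX addrC subrK.
  have [d0|d0] := leP 0 (list_det X).
    apply: F_orbit => //; [by rewrite fD ?normr_eq0|by rewrite sD| |by rewrite dD ger0_norm].
    by apply: contraTneq n2 => X0; move: sX; rewrite X0 => <-.
  case: X sX fX dX d0 => [|p [|q X]] sX fX dX d0; [by exfalso; move: n2; rewrite -sX..|].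
  have fqp : free [:: q, p & X].
    by rewrite (@perm_free _ _ _ [:: p, q & X])// -[X in perm_eq X _]/([:: q] ++ [:: p] ++ X)
      perm_catCA.
  (* Exchanging two vectors keeps the hull and changes the sign of the determinant. *)
  rewrite (cutF.1 _ ([:: q, p & X] ++ O)); last first.
    by apply: eq_mem_hull => x; rewrite !inE orbCA.
  apply: F_orbit => //; [by rewrite fD ?normr_eq0|by rewrite sD|].
  by rewrite dD list_det_swap// ltr0_norm.
exists f; split; last 2 first.
- by rewrite /f ltxx.
- by move=> X v fX sX v0; rewrite (topE X)// (Fv v).
move=> x y; rewrite le_eqVlt => /orP[/eqP <- _|x0].
  by rewrite {2}/f ltxx !add0r.
rewrite le_eqVlt => /orP[/eqP <-|y0].
  by rewrite {3}/f ltxx !addr0.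
have xy0 : 0 < x + y by lra.
have xyN : x + y != 0 by rewrite gt_eqF.
have fX := fD _ xyN; have sX := sD (x + y); have dX := dD (x + y).
case: (D (x + y)) sX fX dX => [|p [|q X]] sX fX dX; [by exfalso; move: n2; rewrite -sX..|].
(* Cutting in this ratio splits the determinant [x + y] into [x] and [y]. *)
have h0 : 0 < x / (x + y) by rewrite divr_gt0.
have h1 : x / (x + y) < 1 by rewrite ltr_pdivrMr//; lra.
have [] := mid_cut h0 h1 fX; set z : V := _ + _ => H fz fpz fzq.
move: H; rewrite (topE _ fX sX) (topE _ fpz sX) (topE _ fzq sX).
rewrite list_det_comb1// list_det_comb// list_det_dup// mulr0 addr0 dX.
rewrite (@cut_constant_low (z :: X) e)//; last exact: (eq_leq sX).
have -> : x / (x + y) * (x + y) = x by field.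
have -> : (1 - x / (x + y)) * (x + y) = y by field.
by rewrite !gtr0_norm//; lra.
Qed.

End Constants.

End SLOrbits.

(** * Invariance and additivity of volume *)

Section LebesgueColumns.
Context (R : realType).
Local Notation T := (measurableTypeR R).
Local Notation leb := (@lebesgue_measure R).

(** The pushforward under the shift agrees with Lebesgue measure on half-open intervals, which
    determine it. *)
Lemma lebesgue_measure_shift (a : R) (S : set T) : measurable S ->
  measurable [set x : T | S (x + a)] /\ leb [set x | S (x + a)] = leb S.
Proof.
pose sh : T -> T := fun x : R => x + a : R.
have ms : measurable_fun [set: T] sh.
  by apply: measurable_funD => //; exact: measurable_cst.
move=> mS; split; first by rewrite -[X in measurable X]setTI; exact: ms.
pose shm : {mfun T >-> T} := mfun_Sub (mem_set ms).
have := @lebesgue_measure_unique R (pushforward leb shm).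
move=> H; rewrite [RHS]H// => _ [[u v] _ <-] /=.
rewrite /pushforward /=.
rewrite (_ : _ @^-1` _ = `]u - a, v - a]%classic).
  rewrite !lebesgue_measure_itv/= !lte_fin ltrD2r.
  by case: ifPn => // _; rewrite -!EFinB; congr (_%:E); ring.
by apply/seteqP; split => x /=; rewrite !in_itv/= ltrBlDr lerBrDr.
Qed.

(** The product measure lives on tuples; [cols], [mcol] and [lamc] carry it over to column vectors,
    on which matrices act. *)
Definition cols n (A : set 'cV[R]_n) : set (n.-tuple T) :=
  [set t | A (\col_i tnth t i)].

Definition mcol n (A : set 'cV[R]_n) : Prop := measurable (cols A).

Definition lamc n (A : set 'cV[R]_n) : \bar R := lebesgue_tuple (cols A).

Lemma mcol_preimage m n (h : 'cV[R]_m -> 'cV[R]_n) (A : set 'cV[R]_n) :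
  (forall i, measurable_fun [set: m.-tuple T]
     (fun t : m.-tuple T => h (\col_j tnth t j) i 0 : T)) ->
  mcol A -> mcol (h @^-1` A).
Proof.
move=> mh mA.
pose g (t : m.-tuple T) : n.-tuple T := [tuple h (\col_j tnth t j) i 0 | i < n].
have mg : measurable_fun setT g.
  apply/measurable_fun_tnthP => i; rewrite (_ : _ \o _ =
    (fun t : m.-tuple T => h (\col_j tnth t j) i 0 : T)) ?mh//.
  by apply/funext => t; rewrite /= tnth_mktuple.
rewrite /mcol (_ : cols _ = setT `&` g @^-1` (cols A)); first exact: mg.
rewrite setTI /cols /preimage; apply/seteqP; split => t /=; congr A;
  by apply/colP => i; rewrite !mxE tnth_mktuple.
Qed.

Lemma measurable_affine n (a : 'rV[R]_n) (b : R) :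
  measurable_fun [set: n.-tuple T]
    (fun t : n.-tuple T => (a *m \col_j tnth t j) 0 0 + b : T).
Proof.
apply: measurable_funD; last exact: measurable_cst.
rewrite (_ : (fun _ => _) = (fun t : n.-tuple T => \sum_j a 0 j * tnth t j)).
  apply: measurable_sum => j; apply: measurable_funM; first exact: measurable_cst.
  exact: measurable_tnth.
by apply/funext => t; rewrite mxE; apply: eq_bigr => j _; rewrite mxE.
Qed.

Lemma mcol_mulmx m n (B : 'M[R]_(n, m)) (A : set 'cV[R]_n) : mcol A ->
  mcol [set x | A (B *m x)].
Proof.
apply: (@mcol_preimage _ _ (fun x => B *m x)) => i.
rewrite (_ : (fun _ => _) =
  (fun t : m.-tuple T => (row i B *m \col_j tnth t j) 0 0 + 0 : T)).
  exact: measurable_affine.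
by apply/funext => t; rewrite addr0 -row_mul [RHS]mxE.
Qed.

Lemma mcol_shift n (v : 'cV[R]_n) (A : set 'cV[R]_n) : mcol A ->
  mcol [set x | A (x + v)].
Proof.
apply: (@mcol_preimage _ _ (fun x => x + v)) => i.
rewrite (_ : (fun _ => _) =
  (fun t : n.-tuple T => ((delta_mx 0 i : 'rV[R]_n) *m \col_j tnth t j) 0 0 + v i 0 : T)).
  exact: measurable_affine.
by apply/funext => t; rewrite -rowE !mxE.
Qed.

Definition cons_col n (x : R) (u : 'cV[R]_n) : 'cV[R]_n.+1 := col_mx (x%:M : 'M[R]_1) u.

Lemma col_cons_tuple n (x : T) (t : n.-tuple T) :
  \col_i tnth [tuple of x :: t] i = cons_col x (\col_i tnth t i).
Proof.
apply/colP => i; rewrite /cons_col !mxE.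
case: (splitP (i : 'I_(1 + n))) => j ij.
  rewrite !mxE ord1 eqxx mulr1n.
  by rewrite (_ : i = ord0) ?tnth0//; apply: val_inj; rewrite /= ij ord1.
rewrite !mxE -(tnthS x t j); congr tnth; apply: val_inj.
by rewrite /= ij.
Qed.

Let consp n (p : T * n.-tuple T) : n.+1.-tuple T := [tuple of p.1 :: p.2].

Let measurable_consp n : measurable_fun [set: T * n.-tuple T] (@consp n).
Proof. exact: measurable_cons. Qed.

Let pairset n (A : set 'cV[R]_n.+1) : set (T * n.-tuple T) :=
  [set p | A (cons_col p.1 (\col_i tnth p.2 i))].

Let pairsetE n (A : set 'cV[R]_n.+1) : @consp n @^-1` (cols A) = pairset A.
Proof.
by apply/seteqP; split => -[x t]; rewrite /pairset /cols /preimage /= col_cons_tuple.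
Qed.

Let measurable_pairset n (A : set 'cV[R]_n.+1) : mcol A -> measurable (pairset A).
Proof.
move=> mA; rewrite -pairsetE -[X in measurable X]setTI.
exact: measurable_consp.
Qed.

Lemma mcol_section n (A : set 'cV[R]_n.+1) x : mcol A -> mcol [set u | A (cons_col x u)].
Proof.
move=> /measurable_pairset mA.
have := measurable_xsection x mA.
by rewrite xsectionE.
Qed.

Lemma measurable_section n (A : set 'cV[R]_n.+1) (t : n.-tuple T) :
  mcol A -> measurable [set x : T | A (cons_col x (\col_i tnth t i))].
Proof.
move=> /measurable_pairset mA.
have := measurable_ysection t mA.
by rewrite ysectionE.
Qed.

Lemma lamc_int1 n (A : set 'cV[R]_n.+1) :
  lamc A = (\int[leb]_x lamc [set u | A (cons_col x u)])%E.
Proof.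
rewrite /lamc /= /pushforward /product_measure1; apply: eq_integral => x _ /=.
congr (lebesgue_tuple _); rewrite xsectionE.
by apply/seteqP; split => t; rewrite /cols /preimage /= col_cons_tuple.
Qed.

(** Tonelli's theorem: here the first coordinate is integrated innermost, which suits maps that move
    only this coordinate. *)
Lemma lamc_int2 n (A : set 'cV[R]_n.+1) : mcol A ->
  lamc A = (\int[lebesgue_tuple (n := n)]_t leb [set x | A (cons_col x (\col_i tnth t i))])%E.
Proof.
move=> mA; have mP := measurable_pairset mA.
have := @indic_fubini_tonelli _ _ _ _ R leb (lebesgue_tuple (n := n)) _ mP.
rewrite indic_fubini_tonelli_FE// indic_fubini_tonelli_GE// => E.
rewrite lamc_int1; transitivity (\int[leb]_x (lebesgue_tuple (n:=n) \o xsection (pairset A)) x)%E.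
  by apply: eq_integral => x _ /=; congr (lebesgue_tuple _); rewrite xsectionE.
rewrite E; apply: eq_integral => t _ /=.
by congr (lebesgue_measure _); rewrite ysectionE.
Qed.

Lemma cons_col_eq n (y : 'cV[R]_n.+1) :
  y = cons_col ((y : 'cV_(1 + n)) (lshift n 0) 0) (dsubmx (y : 'cV_(1 + n))).
Proof.
rewrite /cons_col -[LHS](@vsubmxK R 1 n 1).
by rewrite [usubmx _]mx11_scalar mxE.
Qed.

Lemma cons_colD n (x a : R) (u w : 'cV[R]_n) :
  cons_col x u + cons_col a w = cons_col (x + a) (u + w).
Proof. by rewrite /cons_col raddfD; exact: (@add_col_mx R 1 n 1). Qed.

(** The shift of the first coordinate and the shift of the others are treated separately, each with
    the order of integration in which it acts within slices. *)
Lemma lamc_shift n (v : 'cV[R]_n) (A : set 'cV[R]_n) : mcol A ->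
  lamc [set x | A (x + v)] = lamc A.
Proof.
elim: n v A => [|n IH] v A mA.
  by congr lamc; apply/seteqP; split => x /=; congr A; apply/colP => -[].
rewrite (cons_col_eq v); set a := (X in cons_col X _); set w := dsubmx _.
rewrite lamc_int1.
transitivity (lamc [set y : 'cV[R]_n.+1 | A (y + cons_col a 0)]).
  rewrite lamc_int1; apply: eq_integral => x _.
  rewrite -[RHS](IH w); last first.
    exact: (mcol_section x (mcol_shift (cons_col a 0) mA)).
  by congr lamc; apply/seteqP; split => u /=; rewrite !cons_colD addr0.
rewrite !lamc_int2//; last exact: mcol_shift.
apply: eq_integral => t _; rewrite -[RHS](lebesgue_measure_shift a (measurable_section t mA)).2.
by congr (lebesgue_measure _); apply/seteqP; split => x /=; rewrite cons_colD addr0.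
Qed.

(** * Matrices of determinant 1 preserve Lebesgue measure *)

Definition preserves_lebesgue n (B : 'M[R]_n) : Prop :=
  forall A : set 'cV[R]_n, mcol A -> lamc [set x | A (B *m x)] = lamc A.

Lemma preserves_lebesgue_mul n (B C : 'M[R]_n) : preserves_lebesgue B ->
  preserves_lebesgue C -> preserves_lebesgue (B *m C).
Proof.
move=> pB pC A mA; rewrite -(pB _ mA) -(pC _ (mcol_mulmx B mA)).
by congr lamc; apply/seteqP; split => x /=; rewrite mulmxA.
Qed.

Definition lower_shear n (c : 'cV[R]_n) : 'M[R]_(1 + n) := block_mx 1%:M 0 c 1%:M.
Definition upper_shear n (r : 'rV[R]_n) : 'M[R]_(1 + n) := block_mx 1%:M r 0 1%:M.
Definition unit_block n (B : 'M[R]_n) : 'M[R]_(1 + n) := block_mx 1%:M 0 0 B.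

Lemma block_cons_col n (r : 'rV[R]_n) (c : 'cV[R]_n) (D : 'M[R]_n) x (u : 'cV[R]_n) :
  (block_mx 1%:M r c D : 'M[R]_n.+1) *m cons_col x u =
  cons_col (x + (r *m u) 0 0) (x *: c + D *m u).
Proof.
rewrite [LHS](@mul_block_col R 1 n 1 n 1) mul1mx mul_mx_scalar {1}[r *m u]mx11_scalar.
by rewrite -raddfD.
Qed.

(** On the slice with first coordinate [x] the shear is the translation by [x *: c]. *)
Lemma preserves_lower_shear n (c : 'cV[R]_n) :
  preserves_lebesgue (lower_shear c : 'M[R]_n.+1).
Proof.
move=> A mA; rewrite !lamc_int1; apply: eq_integral => x _.
rewrite -[RHS](lamc_shift (x *: c) (mcol_section x mA)).
by congr lamc; apply/seteqP; split => u /=; rewrite block_cons_col mul0mx mxE addr0 mul1mx addrC.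
Qed.

(** With the other coordinates fixed, the shear translates the first one. *)
Lemma preserves_upper_shear n (r : 'rV[R]_n) :
  preserves_lebesgue (upper_shear r : 'M[R]_n.+1).
Proof.
move=> A mA; rewrite !lamc_int2//; last exact: mcol_mulmx.
apply: eq_integral => t _.
rewrite -[RHS](lebesgue_measure_shift ((r *m \col_i tnth t i) 0 0) (measurable_section t mA)).2.
by congr (lebesgue_measure _); apply/seteqP; split => x /=;
  rewrite block_cons_col scaler0 add0r mul1mx.
Qed.

Lemma preserves_unit_block n (B : 'M[R]_n) : preserves_lebesgue B ->
  preserves_lebesgue (unit_block B : 'M[R]_n.+1).
Proof.
move=> pB A mA; rewrite !lamc_int1; apply: eq_integral => x _.
rewrite -[RHS](pB _ (mcol_section x mA)).
by congr lamc; apply/seteqP; split => u /=;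
  rewrite block_cons_col mul0mx mxE addr0 scaler0 add0r.
Qed.

(* Row operations with the first row generate SL(n + 1) over SL(n). *)
Lemma det1_preserves_lebesgue n (B : 'M[R]_n) : \det B = 1 -> preserves_lebesgue B.
Proof.
elim: n B => [|n IH] B dB.
  move=> A mA; congr lamc; apply/seteqP; split => x /=; congr A;
  by apply/colP => -[].
have pivot (C : 'M[R]_(1 + n)) : \det C = 1 -> dlsubmx C != 0 ->
    preserves_lebesgue (C : 'M[R]_n.+1).
  move=> dC c0; set c := dlsubmx C in c0; set a := ulsubmx C.
  have [i ci] : exists i, c i 0 != 0.
    apply/existsP; apply: contraNT c0 => /existsPn H.
    by apply/eqP/colP => i; rewrite [RHS]mxE; have := H i; rewrite negbK => /eqP.
  (* Adding this multiple of the row with the nonzero entry [c i 0] to the first row turns the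
     corner entry into 1, after which elimination leaves a block [D] of determinant 1. *)
  pose r : 'rV[R]_n := ((1 - a 0 0) / c i 0) *: delta_mx 0 i.
  have rc : r *m c = (1 - a 0 0)%:M.
    by rewrite [LHS]mx11_scalar /r -scalemxAl -rowE mxE [row i c 0 0]mxE divfK.
  have ar : a + r *m c = 1%:M.
    by rewrite rc [LHS]mx11_scalar mxE [X in _ + X]mxE eqxx mulr1n addrC subrK.
  pose s := ursubmx C + r *m drsubmx C.
  pose D := drsubmx C - c *m s.
  have CE : C = upper_shear (- r) *m lower_shear c *m unit_block D *m upper_shear s.
    rewrite -[LHS]submxK -/a -/c /upper_shear /lower_shear /unit_block !mulmx_block.
    rewrite !(mul1mx, mulmx1, mul0mx, mulmx0, addr0, add0r).
    have aE : 1%:M + - r *m c = a by rewrite -ar mulNmx addrK.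
    have DE : c *m s + D = drsubmx C by rewrite /D addrC subrK.
    rewrite aE DE; congr block_mx.
    rewrite -[in RHS]aE mulmxDl mul1mx !mulNmx -mulmxA -addrA -opprD -mulmxDr DE.
    by rewrite /s addrK.
  have dD : \det D = 1.
    move: dC; rewrite CE !det_mulmx /upper_shear /lower_shear /unit_block !det_ublock det_lblock.
    by rewrite !det1 !mul1r !mulr1.
  rewrite CE; apply: (preserves_lebesgue_mul (C := upper_shear s)); last first.
    exact: preserves_upper_shear.
  apply: (preserves_lebesgue_mul (C := unit_block D)); last exact/preserves_unit_block/IH.
  apply: (preserves_lebesgue_mul (C := lower_shear c)); last exact: preserves_lower_shear.
  exact: preserves_upper_shear.
have [c0|c0] := eqVneq (dlsubmx (B : 'M[R]_(1 + n))) 0; last exact: pivot.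
case: n => [|n] in IH B dB pivot c0 *.
  move=> A mA; congr lamc; apply/seteqP; split => x /=; congr A;
  by rewrite [B]mx11_scalar -det_mx11 dB mul1mx.
pose e : 'cV[R]_n.+1 := delta_mx 0 0.
(* If the first column vanishes below the corner, the corner is nonzero; adding the first row to the
   next one creates the entry that [pivot] asks for. *)
pose C : 'M[R]_(1 + n.+1) := lower_shear e *m (B : 'M[R]_(1 + n.+1)).
have shearK : lower_shear (- e) *m lower_shear e = 1%:M.
  rewrite /lower_shear mulmx_block !(mul1mx, mulmx1, mul0mx, mulmx0, addr0, add0r).
  by rewrite addNr -scalar_mx_block.
have BE : B = lower_shear (- e) *m C :> 'M[R]_(1 + n.+1) by rewrite mulmxA shearK mul1mx.
rewrite BE; apply: (preserves_lebesgue_mul (C := C)); first exact: preserves_lower_shear.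
apply: pivot; first by rewrite /C det_mulmx dB /lower_shear det_lblock !det1 !mulr1.
set a := ulsubmx (B : 'M[R]_(1 + n.+1)).
have BB : (B : 'M[R]_(1 + n.+1)) = block_mx a (ursubmx (B : 'M[R]_(1 + n.+1))) 0
    (drsubmx (B : 'M[R]_(1 + n.+1))) by rewrite -c0 submxK.
have a0 : a 0 0 != 0.
  have := congr1 determinant BB; rewrite det_ublock det_mx11 => dBE.
  apply: contra_eq_neq dB => a0; rewrite [X in X != _]dBE a0 mul0r.
  by rewrite eq_sym oner_eq0.
rewrite /C BB /lower_shear mulmx_block block_mxKdl mulmx0 addr0.
apply: contraNneq a0 => /colP/(_ 0); rewrite [a]mx11_scalar mul_mx_scalar !mxE !eqxx mulr1 => ->.
by [].
Qed.

Lemma mcol_image n (B : 'M[R]_n) (A : set 'cV[R]_n) : B \in unitmx -> mcol A ->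
  mcol [set B *m x | x in A].
Proof.
move=> uB mA; rewrite (_ : image _ _ = [set x | A (invmx B *m x)]); first exact: mcol_mulmx.
apply/seteqP; split=> [_ [x Ax <-]|x Ax] /=; first by rewrite mulKmx.
by exists (invmx B *m x) => //; rewrite mulKVmx.
Qed.

Lemma lamc_image n (B : 'M[R]_n) (A : set 'cV[R]_n) : \det B = 1 -> mcol A ->
  lamc [set B *m x | x in A] = lamc A.
Proof.
move=> dB mA; have uB : B \in unitmx by rewrite unitmxE dB unitr1.
rewrite -(det1_preserves_lebesgue dB (mcol_image uB mA)).
congr lamc; apply/seteqP; split=> [x [y Ay]|x Ax] /=; last by exists x.
by move=> /(congr1 (mulmx (invmx B))); rewrite !mulKmx// => <-.
Qed.

(** * Measurability, finiteness and comparison of volumes of hulls *)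

Lemma mcol_hull n (s : seq 'cV[R]_n) : mcol (hull s).
Proof.
have [L HL] := hull_halfspaces s.
have -> : hull s = [set x | forall l, l \in L -> 0 <= hval l x 1].
  by apply/seteqP; split => x /= /HL.
elim: L {HL} => [|l L IH].
  rewrite /mcol (_ : cols _ = setT)//.
  by apply/seteqP; split.
rewrite /mcol (_ : cols _ = cols [set x | 0 <= hval l x 1] `&`
  cols [set x | forall l, l \in L -> 0 <= hval l x 1]).
  apply: measurableI => //.
  have := measurable_affine l.1 l.2 measurableT (measurable_itv `[0, +oo[).
  rewrite setTI; congr measurable; apply/seteqP; split => t;
  by rewrite /cols /hval /= in_itv/= andbT mulr1.
apply/seteqP; split=> t; rewrite /cols /=.
  by move=> H; split => [|k kL]; apply: H; rewrite inE ?eqxx// kL orbT.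
by move=> [H1 H2] k; rewrite inE => /orP[/eqP ->//|/H2].
Qed.

Definition box n (a b : 'I_n -> R) : set 'cV[R]_n := [set x | forall i, a i <= x i 0 <= b i].

Lemma lamc_box n (a b : 'I_n -> R) : (forall i, a i <= b i) ->
  mcol (box a b) /\ lamc (box a b) = (\prod_(i < n) (b i - a i))%:E.
Proof.
move=> ab; pose B i : set T := `[a i, b i]%classic.
have cE : cols (box a b) = [set t | forall i, B i (tnth t i)].
  by apply/seteqP; split => t; rewrite /cols /box /B /= => H i; have := H i; rewrite /= mxE in_itv.
have mB i : measurable (B i) by exact: measurable_itv.
rewrite /mcol /lamc cE; split.
  rewrite (_ : mkset _ = \bigcap_(i in [set: 'I_n]) ((@tnth n _ ^~ (i)) @^-1` B i)).
    apply: fin_bigcap_measurable => //= i _; rewrite -[X in measurable X]setTI.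
    exact: measurable_tnth.
  by apply/seteqP; split => t /= Bt => [i _|i]; exact: Bt.
rewrite lebesgue_tuple_box// -prodEFin; apply: eq_bigr => i _.
rewrite lebesgue_measure_itv/= lte_fin lt_neqAle (ab i) andbT.
by case: eqVneq => [->|_] /=; rewrite ?subrr ?EFinB.
Qed.

Lemma mcol_sub_box n (A : set 'cV[R]_n) (a b : 'I_n -> R) : (forall i, a i <= b i) ->
  mcol A -> A `<=` box a b -> (lamc A <= (\prod_(i < n) (b i - a i))%:E)%E.
Proof.
move=> ab mA AB; have [mB <-] := lamc_box ab.
by apply: le_measure; rewrite ?inE// => t /AB.
Qed.

Lemma box_convex n (a b : 'I_n -> R) : is_convex (box a b).
Proof.
move=> x y t t0 t1 bx bY i; rewrite !mxE.
have /andP[? ?] := bx i; have /andP[? ?] := bY i.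
by apply/andP; split; nra.
Qed.

Lemma hull_sub_convex n (s : seq 'cV[R]_n) (A : set 'cV[R]_n) : is_convex A ->
  (forall p, p \in s -> A p) -> hull s `<=` A.
Proof. by move=> cA sA x; apply; split => //; exact/convex_setE. Qed.

Lemma hull_bounded n (s : seq 'cV[R]_n) :
  exists2 M : R, 0 <= M & hull s `<=` box (fun _ => - M) (fun _ => M).
Proof.
have [M M0 HM] : exists2 M : R, 0 <= M &
    forall p, p \in s -> box (fun _ => - M) (fun _ => M) p.
  elim: s => [|q s [M M0 HM]]; first by exists 0.
  exists (M + \sum_i `|q i 0|); first by rewrite addr_ge0// sumr_ge0.
  move=> p; rewrite inE => /orP[/eqP ->|/HM pM] i.
    rewrite -ler_norml (bigD1 i)//= addrCA lerDl addr_ge0// sumr_ge0//.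
  have q0 : 0 <= \sum_i `|q i 0| by rewrite sumr_ge0.
  have /andP[? ?] := pM i; apply/andP; split; lra.
exists M => //; apply: hull_sub_convex => //; exact: box_convex.
Qed.

Lemma lamc_hull_lt n (s : seq 'cV[R]_n) : (lamc (hull s) < +oo)%E.
Proof.
have [M M0 HM] := hull_bounded s.
apply: (le_lt_trans (mcol_sub_box _ (mcol_hull s) HM)); last exact: ltry.
by move=> i; lra.
Qed.

Lemma lamc_hull_fin n (s : seq 'cV[R]_n) : lamc (hull s) \is a fin_num.
Proof. by rewrite ge0_fin_numE// ?lamc_hull_lt// measure_ge0. Qed.

Lemma volume_ge0 n (A : set 'cV[R]_n) : 0 <= volume A.
Proof. by rewrite /volume fine_ge0// measure_ge0. Qed.

Lemma volumeE n (A : set 'cV[R]_n) : volume A = fine (lamc A).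
Proof. by []. Qed.

Lemma volume_valuation n : valuation (@polytope R 'cV[R]_n) (@volume R n).
Proof.
move=> P Q [s _ ->] [s' _ ->] [s1 _ E1] [s2 _ E2].
rewrite -!/(hull _) in E1 E2 *; rewrite E1 E2 !volumeE -!fineD ?lamc_hull_fin//.
congr fine; rewrite -E2 -E1.
have := @measureUfinl _ _ _ (lebesgue_tuple (n := n)) _ _
  (mcol_hull s) (mcol_hull s') (lamc_hull_lt s).
rewrite -[X in X = _ -> _]/(lamc (hull s `|` hull s')) => ->.
rewrite -[X in (_ - X + _)%E]/(lamc (hull s `&` hull s')) subeK// E1.
exact: lamc_hull_fin.
Qed.

Lemma volume_SL n (B : 'M[R]_n) s : \det B = 1 ->
  volume (hull (map (mulmx B) s)) = volume (hull s).
Proof. by move=> dB; rewrite -hull_map !volumeE lamc_image//; exact: mcol_hull. Qed.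

Lemma volume_sub_box n (s : seq 'cV[R]_n) (a b : 'I_n -> R) : (forall i, a i <= b i) ->
  hull s `<=` box a b -> volume (hull s) <= \prod_(i < n) (b i - a i).
Proof.
move=> ab sub; rewrite volumeE -lee_fin fineK ?lamc_hull_fin//.
by apply: mcol_sub_box => //; exact: mcol_hull.
Qed.

Lemma volume_le n (s s' : seq 'cV[R]_n) : hull s `<=` hull s' ->
  volume (hull s) <= volume (hull s').
Proof.
move=> sub; rewrite !volumeE -lee_fin !fineK ?lamc_hull_fin//.
have mH := mcol_hull s; have mH' := mcol_hull s'.
by apply: le_measure; rewrite ?inE// => t /sub.
Qed.

Lemma volume_sup_box n (s : seq 'cV[R]_n) (a b : 'I_n -> R) : (forall i, a i <= b i) ->
  box a b `<=` hull s -> \prod_(i < n) (b i - a i) <= volume (hull s).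
Proof.
move=> ab sub; rewrite volumeE -lee_fin fineK ?lamc_hull_fin//.
have [mB <-] := lamc_box ab; have mH := mcol_hull s.
by apply: le_measure; rewrite ?inE// => t /sub.
Qed.

End LebesgueColumns.

(** * The origin in the relative interior *)

Section Cones.
Context (R : realType) (n : nat).
Local Notation V := 'cV[R]_n.
Implicit Types (A B C P Q : set V) (x y a b : V).

Definition convex_cone C : Prop :=
  [/\ C 0, forall x y, C x -> C y -> C (x + y) &
      forall (k : R) x, 0 <= k -> C x -> C (k *: x)].

(** For a convex cone this means being a linear subspace. *)
Definition centrally_symmetric C : Prop := forall x, C x -> C (- x).

Lemma symmetric_cone_direction C : convex_cone C -> centrally_symmetric C ->
  [set` direction C] = C.
Proof.
move=> [C0 CD CZ] Cs.
have CZ' k x : C x -> C (k *: x).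
  move=> Cx; have [k0|k0] := leP 0 k; first exact: CZ.
  by rewrite -[k]opprK scaleNr -scalerN; apply: CZ; [lra|exact: Cs].
have aC : affine_set C by move=> x y t Cx Cy; apply: CD; exact: CZ'.
have hC x : affine_hull C x <-> C x.
  by split => [|Cx D [_ CD']]; [apply; split|exact: CD'].
rewrite directionE; last by exists 0.
apply/seteqP; split=> [_ [x /hC Cx [y /hC Cy <-]]|x Cx].
  by apply: CD => //; exact: Cs.
by exists x; [exact/hC|exists 0; [exact/hC|rewrite subr0]].
Qed.

(* The Euler-type functional C |-> (-1) ^ dim C on linear subspaces, extended by
   0 to the other cones; [direction C] is the subspace C itself. *)
Definition cone_sign C : R :=
  if `[< centrally_symmetric C >] then (-1) ^+ \dim (direction C) else 0.

Lemma cone_signT C : centrally_symmetric C -> cone_sign C = (-1) ^+ \dim (direction C).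
Proof. by move=> h; rewrite /cone_sign asboolT. Qed.

Lemma cone_signF C : ~ centrally_symmetric C -> cone_sign C = 0.
Proof. by move=> h; rewrite /cone_sign asboolF. Qed.

(** * Pairs of closed cones with convex union *)

Section TwoCones.
Variables (A B : set V).
Hypotheses (coneA : convex_cone A) (coneB : convex_cone B)
  (coneU : convex_cone (A `|` B)).
Hypotheses (clA : segment_closed A) (clB : segment_closed B).

Let cvx C : convex_cone C -> is_convex C.
Proof. by move=> [_ CD CZ] x y t t0 t1 Cx Cy; apply: CD; apply: CZ => //; lra. Qed.

Lemma cone_crossing a b : A a -> ~ B a -> B b -> ~ A b ->
  exists2 t : R, 0 < t < 1 & (A `&` B) (t *: b + (1 - t) *: a).
Proof.
move=> Aa Ba Bb Ab.
have [|t [t0 t1 At Bt]] := segment_crossing (cvx coneA) clA clB Aa Bb.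
  by move=> t t0 t1; apply: (cvx coneU) => //; [right|left].
exists t => //; apply/andP; split.
  rewrite lt_neqAle t0 andbT; apply/eqP => t00; apply: Ba.
  by move: Bt; rewrite -t00 scale0r add0r subr0 scale1r.
rewrite lt_neqAle t1 andbT; apply/eqP => t11; apply: Ab.
by move: At; rewrite t11 subrr scale0r addr0 scale1r.
Qed.

(** If [A] were symmetric, [t *: b + a] with [t > 0] could not lie in [A], as subtracting [a] would
    put [b] there. So it lies in [B], and letting [t] tend to 0 gives [a] in [B]. *)
Lemma nonnested_not_symmetric a b : A a -> ~ B a -> B b -> ~ A b -> ~ centrally_symmetric A.
Proof.
move=> Aa Ba Bb Ab sA; apply: Ba; have [_ AD AZ] := coneA; have [_ BD BZ] := coneB.
apply: (clB (y := a + b)) => t t0 t1.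
have -> : t *: (a + b) + (1 - t) *: a = t *: b + a by entrywise; ring.
have [_ UD UZ] := coneU.
have [h|//] : (A `|` B) (t *: b + a).
  by apply: (UD); [right; apply: (BZ) => //; exact: ltW|left].
exfalso; apply: Ab.
have -> : b = t^-1 *: ((t *: b + a) + (- a)).
  by rewrite addrK scalerA mulVf ?scale1r// gt_eqF.
by apply: (AZ); [rewrite invr_ge0 ltW|apply: (AD) => //; exact: sA].
Qed.

(** A point [x] of only one cone is joined to a point of only the other cone. The segment crosses
    the intersection, and [- x] is a nonnegative combination of its far end and the negative of the
    crossing point. *)
Lemma symmetric_setU a b : A a -> ~ B a -> B b -> ~ A b ->
  centrally_symmetric (A `&` B) -> centrally_symmetric (A `|` B).
Proof.
move=> Aa Ba Bb Ab sI; have [_ AD AZ] := coneA; have [_ BD BZ] := coneB.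
move=> x [Ax|Bx].
  have [Bx|Bx] := pselect (B x); first by left; have [] := sI x (conj Ax Bx).
  have [t /andP[t0 t1] /sI] := cone_crossing Ax Bx Bb Ab; set m := - _ => -[_ Bm].
  right; have -> : - x = (1 - t)^-1 *: (t *: b + m).
    by rewrite /m; entrywise; field; rewrite gt_eqF//; lra.
  by apply: (BZ); [rewrite invr_ge0; lra|apply: (BD) => //; apply: (BZ) => //; lra].
have [Ax|Ax] := pselect (A x); first by left; have [] := sI x (conj Ax Bx).
have [t /andP[t0 t1] /sI] := cone_crossing Aa Ba Bx Ax; set m := - _ => -[Am _].
left; have -> : - x = t^-1 *: ((1 - t) *: a + m).
  by rewrite /m; entrywise; field; rewrite gt_eqF//; lra.
by apply: (AZ); [rewrite invr_ge0; lra|apply: (AD) => //; apply: (AZ) => //; lra].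
Qed.

End TwoCones.

(** The points [t *: b - x] with [t > 0] cannot lie in [A], since adding [x] would put [b] there;
    their limit [- x] therefore lies in [B]. *)
Lemma symmetric_setI_half A B b : convex_cone A -> convex_cone B ->
  convex_cone (A `|` B) -> segment_closed B -> B b -> ~ A b ->
  centrally_symmetric (A `|` B) -> forall x, (A `&` B) x -> A (- x) -> B (- x).
Proof.
move=> [_ AD AZ] [_ BD BZ] [_ UD UZ] clB Bb Ab sU x [Ax Bx] Anx.
apply: (clB _ (b - x)) => t t0 t1.
have -> : t *: (b - x) + (1 - t) *: - x = t *: b - x by entrywise; ring.
have [h|//] : (A `|` B) (t *: b - x).
  by apply: (UD); [right; apply: (BZ) => //; exact: ltW|left].
exfalso; apply: Ab.
have -> : b = t^-1 *: ((t *: b - x) + x).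
  by rewrite subrK scalerA mulVf ?scale1r// gt_eqF.
by apply: (AZ); [rewrite invr_ge0 ltW|exact: AD].
Qed.

Lemma cone_sign_valuation A B : convex_cone A -> convex_cone B ->
  convex_cone (A `|` B) -> segment_closed A -> segment_closed B ->
  cone_sign A + cone_sign B = cone_sign (A `|` B) + cone_sign (A `&` B).
Proof.
move=> cA cB cU clA clB.
have [AB|AB] := pselect (A `<=` B).
  by rewrite (setUidr AB) (setIidl AB) addrC.
have [BA|BA] := pselect (B `<=` A).
  by rewrite (setUidl BA) (setIidr BA).
have [a [Aa Ba]] : exists a, A a /\ ~ B a.
  by apply: contrapT => H; apply: AB => x Ax; apply: contrapT => Bx; apply: H; exists x.
have [b [Bb Ab]] : exists b, B b /\ ~ A b.
  by apply: contrapT => H; apply: BA => x Bx; apply: contrapT => Ax; apply: H; exists x.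
have cU' : convex_cone (B `|` A) by rewrite setUC.
rewrite (cone_signF (nonnested_not_symmetric cA cB cU clB Aa Ba Bb Ab)).
rewrite (cone_signF (nonnested_not_symmetric cB cA cU' clA Bb Ab Aa Ba)) addr0.
have cI : convex_cone (A `&` B).
  have [A0 AD AZ] := cA; have [B0 BD BZ] := cB; split => //.
  - by move=> x y [? ?] [? ?]; split; [exact: AD|exact: BD].
  - by move=> k x k0 [? ?]; split; [exact: AZ|exact: BZ].
have [sI|sI] := pselect (centrally_symmetric (A `&` B)); last first.
  rewrite (cone_signF sI) cone_signF ?addr0// => sU; apply: sI => x ABx.
  have sU' : centrally_symmetric (B `|` A) by rewrite setUC.
  have [Ax Bx] := ABx.
  have [Anx|Bnx] := sU x (or_introl Ax); split => //.
  - exact: (symmetric_setI_half cA cB cU clB Bb Ab sU ABx Anx).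
  - exact: (symmetric_setI_half cB cA cU' clA Aa Ba sU' (conj Bx Ax) Bnx).
have sU := symmetric_setU cA cB cU clA clB Aa Ba Bb Ab sI.
rewrite !cone_signT//.
have UE := symmetric_cone_direction cU sU; have IE := symmetric_cone_direction cI sI.
set W := direction (A `|` B) in UE *; set M := direction (A `&` B) in IE *.
have inW x : x \in W <-> (A `|` B) x by rewrite -UE.
have inM x : x \in M <-> (A `&` B) x by rewrite -IE.
have dW : \dim W = (\dim M).+1.
  have aM : a \notin M by apply/negP => /inM[].
  have a0 : a != 0 by apply: contraNneq aM => ->; rewrite mem0v.
  (* A point of [B] outside [A] is reached from [a] through the crossing point in [M]; a point of
     [A] outside [B] is reached likewise from [b], which is already covered. *)
  have -> : W = (M + <[a]>)%VS.
    apply/eqP; rewrite eqEsubv; apply/andP; split; last first.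
      apply/subvP => _ /memv_addP[m /inM[Am Bm] [_ /vlineP[k ->] ->]].
      by apply: rpredD; [apply/inW; left|apply: rpredZ; apply/inW; left].
    have Bpart y : B y -> ~ A y -> y \in (M + <[a]>)%VS.
      move=> By Ay; have [t /andP[t0 t1] /inM tM] := cone_crossing cA cU clA clB Aa Ba By Ay.
      have -> : y = t^-1 *: (t *: y + (1 - t) *: a) + (- (1 - t) / t) *: a.
        by entrywise; field; rewrite gt_eqF.
      by apply: memv_add; [exact: rpredZ|apply: rpredZ; exact: memv_line].
    apply/subvP => y /inW yU.
    have [Ay|Ay] := pselect (A y); last by case: yU => // By; exact: Bpart.
    have [By|By] := pselect (B y).
      by rewrite -[y]addr0; apply: memv_add; [exact/inM|exact: mem0v].
    have [t /andP[t0 t1] /inM tM] := cone_crossing cA cU clA clB Ay By Bb Ab.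
    have -> : y = (1 - t)^-1 *: (t *: b + (1 - t) *: y) + (- t / (1 - t)) *: b.
      by entrywise; field; rewrite gt_eqF//; lra.
    apply: rpredD; apply: rpredZ; last exact: Bpart.
    by rewrite -[X in X \in _]addr0; apply: memv_add => //; exact: mem0v.
  rewrite dimv_disjoint_sum ?dim_vline ?a0 ?addn1//.
  apply/eqP; rewrite -subv0; apply/subvP => y; rewrite memv_cap => /andP[yM /vlineP[k yk]].
  rewrite memv0; apply: contraNT aM => y0.
  have k0 : k != 0 by apply: contraNneq y0 => k0; rewrite yk k0 scale0r.
  by rewrite -[a]scale1r -(mulVf k0) -scalerA -yk rpredZ.
by rewrite dW exprS mulN1r addNr.
Qed.

(** Used for convex [P] containing 0: then the whole segment from 0 to [e *: x] lies in [P], and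
    this is the cone of feasible directions at 0. *)
Definition tangent_cone P : set V := [set x | exists2 e : R, 0 < e & P (e *: x)].

Lemma convex_shrink P x (e d : R) : is_convex P -> P 0 -> 0 <= d -> d <= e ->
  P (e *: x) -> P (d *: x).
Proof.
move=> cP P0 d0; rewrite le_eqVlt => /orP[/eqP ->//|de Px].
have k0 : 0 <= d / e by rewrite divr_ge0//; lra.
have k1 : d / e <= 1 by rewrite ler_pdivrMr; lra.
have := cP _ _ _ k0 k1 Px P0; rewrite scaler0 addr0 scalerA divfK// gt_eqF//; lra.
Qed.

Lemma tangent_cone_cone P : is_convex P -> P 0 -> convex_cone (tangent_cone P).
Proof.
move=> cP P0; split.
- by exists 1 => //; rewrite scaler0.
- move=> x y [e e0 Px] [d d0 Py].
  pose m := Num.min e d.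
  have m0 : 0 < m by rewrite lt_min e0 d0.
  have mx : P (m *: x) by apply: convex_shrink Px => //; rewrite ?ge_min ?lexx// ltW.
  have my : P (m *: y) by apply: convex_shrink Py => //; rewrite ?ge_min ?lexx ?orbT// ltW.
  exists (2^-1 * m); first by rewrite mulr_gt0.
  have h0 : 0 <= 2^-1 :> R by lra.
  have h1 : 2^-1 <= 1 :> R by lra.
  by have := cP _ _ _ h0 h1 mx my; congr P; entrywise; field.
- move=> k x k0 [e e0 Px]; move: k0; rewrite le_eqVlt => /orP[/eqP <-|k0].
    by exists 1 => //; rewrite scale0r scaler0.
  exists (e / k); first by rewrite divr_gt0.
  by rewrite scalerA divfK// gt_eqF.
Qed.

(** The cone is cut out by the linear parts of the forms that vanish at 0; the finitely many other
    forms are positive at 0 and stay nonnegative for small multiples. *)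
Lemma tangent_cone_segment_closed P : polytope P -> P 0 ->
  segment_closed (tangent_cone P).
Proof.
move=> pP; have [s s0 PE] := pP.
have [L HL] := hull_halfspaces s; rewrite -/(hull s) in PE; rewrite PE => /HL P0.
have hval0 l : hval l (0 : V) 1 = l.2 by rewrite /hval mulmx0 mxE add0r mulr1.
have tcE x : tangent_cone (hull s) x <->
    forall l, l \in L -> l.2 = 0 -> 0 <= hval l x 0.
  split=> [[e e0 /HL H] l lL l0|H].
    have := H l lL; rewrite /hval l0 -scalemxAr !mxE; nra.
  have [e e0 He] : exists2 e : R, 0 < e & forall l, l \in L -> 0 <= hval l (e *: x) 1.
    elim: (L) P0 H => [|l L' IH] P0 H; first by exists 1.
    have [k kL|k kL|e e0 He] := IH.
    - by apply: P0; rewrite inE kL orbT.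
    - by apply: H; rewrite inE kL orbT.
    have lL : l \in l :: L' := mem_head _ _.
    have l2 : 0 <= l.2 by rewrite -hval0 P0.
    have [d d0 Hd] : exists2 d : R, 0 < d & 0 <= hval l (d *: x) 1.
      have hE d : hval l (d *: x) 1 = d * hval l x 0 + l.2.
        by rewrite /hval -scalemxAr !mxE; ring.
      have [l20|l20] := eqVneq l.2 0.
        by exists 1 => //; rewrite hE l20 addr0 mul1r H.
      have lp : 0 < l.2 by rewrite lt_neqAle eq_sym l20.
      (* The step is so short that the linear part changes the positive value [l.2] at 0 by less
         than [l.2]. *)
      exists (l.2 / (1 + `|hval l x 0|)); first by rewrite divr_gt0// ltr_pwDl.
      rewrite hE; set h := hval l x 0.
      have hp : 0 < 1 + `|h| by rewrite ltr_pwDl.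
      have -> : l.2 / (1 + `|h|) * h + l.2 = l.2 * (1 + `|h| + h) / (1 + `|h|).
        by field; rewrite gt_eqF.
      apply: divr_ge0; last exact: ltW.
      by apply: mulr_ge0 => //; have := ler_norm (- h); rewrite normrN; lra.
    have shrink (k : 'rV[R]_n * R) (u v : R) : 0 <= k.2 -> 0 <= u -> u <= v ->
        0 <= hval k (v *: x) 1 -> 0 <= hval k (u *: x) 1.
      rewrite /hval -!scalemxAr !mxE => k0 u0 uv.
      by case: (leP 0 (\sum_j k.1 0 j * x j 0)) => h0; nra.
    exists (Num.min d e); first by rewrite lt_min d0 e0.
    move=> k; rewrite inE => /orP[/eqP ->|kL].
      apply: shrink Hd => //; last by rewrite ge_min lexx.
      by rewrite le_min (ltW d0) (ltW e0).
    apply: shrink (He k kL) => //; last by rewrite ge_min lexx orbT.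
      by rewrite -hval0 P0// inE kL orbT.
    by rewrite le_min (ltW d0) (ltW e0).
  by exists e => //; exact/HL.
move=> x y H; apply/tcE => l lL l0; apply: (@affine_limit _ _ (hval l y 0)) => t t0 t1.
have := (tcE _).1 (H t t0 t1) l lL l0.
rewrite /hval mulmxDr -!scalemxAr !mxE; lra.
Qed.

(** The sum is the average of the points [m%:R *: u i]; membership of 0 covers [m = 0]. *)
Lemma convex_average P m (u : 'I_m -> V) : is_convex P -> P 0 ->
  (forall i, P (m%:R *: u i)) -> P (\sum_i u i).
Proof.
move=> cP P0; elim: m u => [|m IH] u Pu; first by rewrite big_ord0.
rewrite big_ord_recr /=.
case: m => [|m] in IH u Pu *.
  by have := Pu ord_max; rewrite scale1r big_ord0 add0r.
move: Pu; set k := m.+1 => Pu; have mN : k%:R != 0 :> R by rewrite pnatr_eq0.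
have m1N : k.+1%:R != 0 :> R by rewrite pnatr_eq0.
pose w i := (k.+1%:R / k%:R) *: u (widen_ord (leqnSn k) i).
have Pw : P (\sum_i w i).
  by apply: IH => i; rewrite scalerA mulrC divfK.
have k0 : 0 <= k%:R / k.+1%:R :> R by rewrite divr_ge0.
have k1 : k%:R / k.+1%:R <= 1 :> R by rewrite ler_pdivrMr ?ltr0n// mul1r ler_nat.
have := cP _ _ _ k0 k1 Pw (Pu ord_max); congr P.
rewrite /w -scaler_sumr !scalerA; congr (_ + _).
  by rewrite mulrA divfK// mulfV// scale1r.
rewrite -[RHS]scale1r; congr (_ *: _).
by rewrite -natr1 in m1N *; field.
Qed.

(** From left to right, short negative multiples of feasible directions are in the affine hull and
    near 0. Conversely the tangent cone is a subspace containing the affine hull, and points of the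
    hull near 0 are averages of short multiples of basis vectors. *)
Lemma relint0P P : is_convex P -> relint P 0 <-> P 0 /\ centrally_symmetric (tangent_cone P).
Proof.
move=> cP; split.
  move=> [H0 /nbhs_norm0P[e /= e0 He]].
  have P0 : P 0 by apply: He => //=; rewrite normr0.
  split => // x [d d0 Px].
  have hP t : affine_hull P (t *: (d *: x)).
    have hx : affine_hull P (d *: x) by move=> B [_]; apply.
    by have := affine_hull_affine t hx H0; rewrite scaler0 addr0.
  have [x0|x0] := eqVneq x 0; first by exists 1 => //; rewrite x0 oppr0 scaler0.
  (* With this [t] the vector [(t * d) *: x] has norm [e / 2]. *)
  pose t := e / 2 / (d * `|x|).
  have nx : 0 < `|x| by rewrite normr_gt0.
  have t0 : 0 < t by rewrite /t !divr_gt0// mulr_gt0.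
  exists (t * d); first exact: mulr_gt0.
  rewrite scalerN -scaleNr -mulNr -scalerA; apply: He => //=.
  rewrite scalerA normrZ normrM normrN !gtr0_norm//.
  by rewrite -mulrA /t divfK ?gt_eqF ?mulr_gt0//; lra.
move=> [P0 sP]; have cT := tangent_cone_cone cP P0.
have TE := symmetric_cone_direction cT sP.
set W := direction _ in TE.
have inW x : x \in W <-> tangent_cone P x by rewrite -TE.
have hW x : affine_hull P x -> x \in W.
  move=> /(_ [set` W]); apply; split => [y z t /= yW zW|y Py].
    by apply: rpredD; exact: rpredZ.
  by apply/inW; exists 1 => //; rewrite scale1r.
split; first by move=> B [_]; apply.
suff : \forall x \near (0 : V), affine_hull P x -> P x by [].
apply/nbhs_norm0P.
pose X := vbasis W.
have [e e0 He] : exists2 e : R, 0 < e & forall i (t : R), `|t| <= e -> P (t *: X`_i).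
  have Hi x : x \in W -> exists2 e : R, 0 < e & forall t : R, `|t| <= e -> P (t *: x).
    move=> xW; have /inW[e e0 Px] := xW; have /inW[d d0 Pnx] : - x \in W by rewrite rpredN.
    exists (Num.min e d); first by rewrite lt_min e0 d0.
    move=> t; rewrite le_min => /andP[te td]; have [t0|t0] := leP 0 t.
      by apply: convex_shrink Px => //; rewrite ger0_norm in te.
    rewrite -[t]opprK scaleNr -scalerN; apply: convex_shrink Pnx => //; first by lra.
    by rewrite ltr0_norm in td.
  suff gen (s : seq V) : {subset s <= W} ->
      exists2 e : R, 0 < e & forall i (t : R), `|t| <= e -> P (t *: s`_i).
    by apply: gen => x /vbasis_mem.
  elim: s => [|x s IH] sW.
    by exists 1 => // i t _; rewrite nth_nil scaler0.
  have sW' : {subset s <= W} by move=> y ys; apply: sW; rewrite inE ys orbT.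
  have [e e0 He] := IH sW'.
  have [d d0 Hd] := Hi x (sW x (mem_head _ _)).
  exists (Num.min d e); first by rewrite lt_min d0 e0.
  by move=> [|i] t; rewrite le_min => /andP[td te] /=; [exact: Hd|exact: He].
pose N := \dim W.
(* Summing over all coordinate functions gives one Lipschitz constant for each of them. *)
pose K := \sum_(i < N) \sum_j `|coord X i (delta_mx j 0 : V)|.
have K0 : 0 <= K by rewrite sumr_ge0// => i _; rewrite sumr_ge0.
have coordK i x : `|coord X i x| <= K * `|x|.
  have xE : x = \sum_j x j 0 *: (delta_mx j 0 : V).
    by rewrite {1}[x]matrix_sum_delta; apply: eq_bigr => j _; rewrite big_ord1.
  rewrite {1}xE linear_sum /=; apply: (le_trans (ler_norm_sum _ _ _)).
  rewrite mulr_suml (bigD1 i)//= -[X in X <= _]addr0.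
  apply: lerD; last by rewrite sumr_ge0// => k _; rewrite mulr_ge0// sumr_ge0.
  rewrite mulr_suml; apply: ler_sum => j _.
  rewrite linearZ normrM mulrC ler_wpM2l//.
  by rewrite [X in _ <= X]mx_normrE; exact: (le_bigmax _ (fun k => `|x k.1 k.2|) (j, 0)).
(* The radius keeps [N] times every coordinate at most [e], as averaging over the [N] basis vectors
   demands; the summand 1 prevents division by 0. *)
exists (e / (1 + N%:R * K)) => /=.
  by rewrite divr_gt0// ltr_pwDl// mulr_ge0.
move=> x /= xe /hW xW.
have xE := coord_vbasis xW; rewrite xE; apply: convex_average => // i.
rewrite scalerA; apply: He; rewrite normrM normr_nat.
have Dp : 0 < 1 + N%:R * K by rewrite ltr_pwDl// mulr_ge0.
move: xe; rewrite ltr_pdivlMr// => xe.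
have := coordK i x.
have : 0 <= N%:R :> R by [].
have : 0 <= `|x| by [].
move: (`|coord X i x|) (N%:R : R) (`|x|) xe K0 => u v w; nra.
Qed.

Lemma affdim_relint0 P : is_convex P -> relint P 0 ->
  affdim P = \dim (direction (tangent_cone P)).
Proof.
move=> cP /(relint0P cP)[P0 sP].
have cT := tangent_cone_cone cP P0.
have TE := symmetric_cone_direction cT sP.
rewrite /affdim; congr (\dim _).
have hP0 : affine_hull P 0 by move=> B [_]; apply.
have hW x : affine_hull P x -> tangent_cone P x.
  rewrite -TE => /(_ [set` direction (tangent_cone P)]); apply; split => [y z t /= yW zW|y Py].
    by apply: rpredD; exact: rpredZ.
  by rewrite TE; exists 1 => //; rewrite scale1r.
have [_ TD _] := cT.
apply/vspaceP => x; apply/idP/idP => xP.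
  have : [set` direction P] x := xP; rewrite directionE; last by exists 0.
  move=> [y /hW Ty [z /hW Tz <-]].
  suff : [set` direction (tangent_cone P)] (y - z) by [].
  by rewrite TE; apply: TD => //; exact: sP.
have : [set` direction (tangent_cone P)] x := xP; rewrite TE => -[e e0 Px].
suff : [set` direction P] x by [].
rewrite directionE; last by exists 0.
exists x; last by exists 0 => //; rewrite subr0.
have hx : affine_hull P (e *: x) by move=> B [_]; apply.
have := affine_hull_affine e^-1 hx hP0.
by rewrite scaler0 addr0 scalerA mulVf ?scale1r// gt_eqF.
Qed.

Definition relint_sign P : R := (-1) ^+ affdim P * \1_(relint P) 0.

Lemma relint_signE P : is_convex P ->
  relint_sign P = if `[< P 0 >] then cone_sign (tangent_cone P) else 0.
Proof.
move=> cP; rewrite /relint_sign indicE.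
have [rP|rP] := pselect (relint P 0).
  rewrite mem_set// mulr1 affdim_relint0//.
  by have /(relint0P cP)[P0 sP] := rP; rewrite asboolT// cone_signT.
rewrite memNset// mulr0; case: asboolP => // P0; rewrite cone_signF// => sP.
by apply: rP; apply/relint0P.
Qed.

(** A direction feasible for the union but not for [P] would have all its short multiples in [Q],
    and closedness would put 0 into [Q]. *)
Lemma tangent_cone_setU P Q : is_convex (P `|` Q) -> is_convex P ->
  P 0 -> ~ Q 0 -> segment_closed Q -> tangent_cone (P `|` Q) = tangent_cone P.
Proof.
move=> cU cP P0 Q0 clQ; apply/seteqP; split; last by move=> x [e e0 Px]; exists e => //; left.
move=> x [e e0 PQx]; apply: contrapT => nT; apply: Q0.
apply: (clQ _ (e *: x)) => t t0 t1; rewrite scaler0 addr0 scalerA.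
have te : 0 < t * e by rewrite mulr_gt0.
have [|//] : (P `|` Q) ((t * e) *: x).
  apply: (@convex_shrink _ _ e) => //; [by left|exact: ltW|].
  by rewrite ler_piMl// ltW.
by move=> Px; exfalso; apply: nT; exists (t * e).
Qed.

Lemma relint_sign_valuation : valuation (@polytope R V) relint_sign.
Proof.
move=> P Q pP pQ pI pU.
have cP := polytope_convex pP; have cQ := polytope_convex pQ.
have cI := polytope_convex pI; have cU := polytope_convex pU.
have clP := polytope_segment_closed pP; have clQ := polytope_segment_closed pQ.
rewrite !relint_signE//.
case: (asboolP (P 0)) => P0; case: (asboolP (Q 0)) => Q0; last first.
- rewrite !asboolF//; last by case.
  by case.
- rewrite asboolT; last by right.
  rewrite asboolF; last by case.
  rewrite setUC tangent_cone_setU 1?setUC//.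
  by rewrite addr0 add0r.
- rewrite asboolT; last by left.
  rewrite asboolF; last by case.
  by rewrite tangent_cone_setU.
rewrite asboolT; last by left.
rewrite asboolT//.
have -> : tangent_cone (P `|` Q) = tangent_cone P `|` tangent_cone Q.
  apply/seteqP; split=> x; first by move=> [e e0 [?|?]]; [left|right]; exists e.
  by move=> [|] [e e0 ?]; exists e => //; [left|right].
have -> : tangent_cone (P `&` Q) = tangent_cone P `&` tangent_cone Q.
  apply/seteqP; split=> x; first by move=> [e e0 [? ?]]; split; exists e.
  move=> [[e e0 Px] [d d0 Qx]]; exists (Num.min e d); first by rewrite lt_min e0.
  by split; [apply: convex_shrink Px|apply: convex_shrink Qx] => //;
    rewrite ?ge_min ?lexx ?orbT// le_min !ltW.
have -> // := @cone_sign_valuation (tangent_cone P) (tangent_cone Q).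
- exact: tangent_cone_cone.
- exact: tangent_cone_cone.
- have := tangent_cone_cone cU (or_introl P0).
  congr convex_cone; apply/seteqP; split=> x; first by move=> [e e0 [?|?]]; [left|right]; exists e.
  by move=> [|] [e e0 ?]; exists e => //; [left|right].
- exact: tangent_cone_segment_closed.
- exact: tangent_cone_segment_closed.
Qed.

Lemma cone_sign_image (B : 'M[R]_n) C : B \in unitmx -> convex_cone C ->
  cone_sign [set B *m x | x in C] = cone_sign C.
Proof.
move=> uB cC; have [C0 CD CZ] := cC.
have cBC : convex_cone [set B *m x | x in C].
  split; first by exists 0 => //; rewrite mulmx0.
  - by move=> _ _ [x Cx <-] [y Cy <-]; exists (x + y); [exact: CD|rewrite mulmxDr].
  - by move=> k _ k0 [x Cx <-]; exists (k *: x); [exact: CZ|rewrite -scalemxAr].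
have [sC|sC] := pselect (centrally_symmetric C); last first.
  rewrite !cone_signF// => sBC; apply: sC => x Cx.
  have [|y Cy] := sBC (B *m x); first by exists x.
  by move=> /(congr1 (mulmx (invmx B))); rewrite mulmxN !mulKmx// => <-.
have sBC : centrally_symmetric [set B *m x | x in C].
  by move=> _ [x Cx <-]; exists (- x); [exact: sC|rewrite mulmxN].
rewrite !cone_signT//; congr (_ ^+ _).
pose f : 'Hom(V, V) := linfun (mulmx B).
have kf : lker f = 0%VS.
  apply/eqP/lker0P => x y; rewrite !lfunE /= => /(congr1 (mulmx (invmx B))).
  by rewrite !mulKmx.
rewrite -(@limg_dim_eq _ _ _ f (direction C)) ?kf ?capv0//; congr (\dim _).
have TE := symmetric_cone_direction cC sC.
have TBE := symmetric_cone_direction cBC sBC.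
apply/vspaceP => x; apply/idP/memv_imgP => [xB|[y yC ->]].
  have : [set` direction [set B *m x | x in C]] x := xB; rewrite TBE => -[y Cy <-].
  by exists y; [rewrite -TE in Cy|rewrite lfunE].
have : [set` direction C] y := yC; rewrite TE => Cy.
suff : [set` direction [set B *m x | x in C]] (f y) by [].
by rewrite TBE lfunE; exists y.
Qed.

Lemma relint_sign_SL : SL_invariant (@polytope R V) relint_sign.
Proof.
move=> B P dB pP; have cP := polytope_convex pP.
have uB : B \in unitmx by rewrite unitmxE dB unitr1.
have cBP : is_convex [set B *m x | x in P].
  move=> _ _ t t0 t1 [x Px <-] [y Py <-]; exists (t *: x + (1 - t) *: y); first exact: cP.
  by rewrite mulmxDr -!scalemxAr.
rewrite !relint_signE//.
have -> : [set B *m x | x in P] 0 = P 0.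
  apply/propext; split=> [[x Px Bx]|P0]; last by exists 0 => //; rewrite mulmx0.
  by move: Bx Px => /(congr1 (mulmx (invmx B))); rewrite mulmx0 mulKmx// => ->.
case: asboolP => // P0.
rewrite -(cone_sign_image uB (tangent_cone_cone cP P0)); congr cone_sign.
apply/seteqP; split=> x.
  move=> [e e0 [y Py yE]]; exists (e^-1 *: y).
    by exists e => //; rewrite scalerA mulfV ?scale1r// gt_eqF.
  by rewrite -scalemxAr yE scalerA mulVf ?scale1r// gt_eqF.
move=> [y [e e0 Py] <-]; exists e => //; exists (e *: y) => //.
by rewrite -scalemxAr.
Qed.

End Cones.

(** * Classification *)

Section Cauchy.
Context (R : realType).

(** Nonnegativity makes the solution monotone, and a monotone solution is squeezed between multiples
    of [f 1]. It is applied to the Cauchy functions that describe volume. *)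
Lemma cauchy_ge0_linear (f : R -> R) : cauchy_solution f ->
  (forall x, 0 <= x -> 0 <= f x) -> forall x, 0 <= x -> f x = x * f 1.
Proof.
move=> cf f0 x x0.
have fM m y : 0 <= y -> f (m%:R * y) = m%:R * f y.
  move=> y0; elim: m => [|m IH].
    by rewrite !mul0r; have := cf 0 0 (lexx _) (lexx _); rewrite addr0; lra.
  by rewrite -natr1 !mulrDl !mul1r cf ?IH// mulr_ge0.
have mono y z : 0 <= y -> y <= z -> f y <= f z.
  move=> y0 yz; have -> : z = y + (z - y) by ring.
  by rewrite cf//; [have := f0 (z - y); lra|lra].
apply/eqP; rewrite -subr_eq0 -normr_le0 leNgt; apply/negP.
set c := `|_| => c0.
(* [m] is so large that [m] times the deviation [c] exceeds [f 1], while enclosing [m%:R * x]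
   between consecutive integers bounds that product by [f 1]. *)
pose m := (Num.truncn (f 1 / c)).+1.
have f10 : 0 <= f 1 by exact: f0.
have mc : f 1 < m%:R * c.
  rewrite -ltr_pdivrMr//.
  by have /andP[_] := truncn_itv (divr_ge0 f10 (ltW c0)).
have mx0 : 0 <= m%:R * x by rewrite mulr_ge0.
have /andP[k1 k2] := truncn_itv mx0.
set k := Num.truncn _ in k1 k2.
have kf1 : k%:R * f 1 <= m%:R * f x.
  by rewrite -(fM k)// -(fM m)//; apply: mono; rewrite ?mulr1.
have kf2 : m%:R * f x <= k.+1%:R * f 1.
  by rewrite -(fM k.+1)// -(fM m)//; apply: mono; rewrite ?mulr1// ltW.
have : m%:R * c <= f 1.
  rewrite /c -[m%:R](normr_nat R) -normrM ler_norml mulrBr.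
  move: kf1 kf2 k1 k2; rewrite -natr1.
  move: (k%:R : R) (m%:R : R) => kk mm; nra.
by rewrite leNgt mc.
Qed.

Lemma cauchy_solution0 (f : R -> R) : cauchy_solution f -> f 0 = 0.
Proof. by move=> cf; have := cf 0 0 (lexx _) (lexx _); rewrite addr0; lra. Qed.

End Cauchy.

(** * The five functionals are SL(n) invariant valuations *)

Section Formula.
Context (R : realType) (n : nat).
Local Notation V := 'cV[R]_n.
Variables (c0 c0' d0 : R) (phi psi : R -> R).
Hypotheses (cphi : cauchy_solution phi) (cpsi : cauchy_solution psi).

Definition standard_functional (P : set V) : R :=
  c0 * euler_char P
  + c0' * ((-1) ^+ affdim P * \1_(relint P) 0)
  + psi (volume P)
  + d0 * \1_P 0
  + phi (volume (conv_hull ([set 0] `|` P))).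

Lemma euler_char_polytope (P : set V) : polytope P -> euler_char P = 1 :> R.
Proof.
by move=> /polytope_nonempty/set0P P0; rewrite /euler_char (negbTE P0).
Qed.

Lemma standard_functional_valuation : valuation (@polytope R V) standard_functional.
Proof.
move=> P Q pP pQ pI pU; rewrite /standard_functional -!/(relint_sign _).
rewrite !euler_char_polytope//.
have e1 := relint_sign_valuation pP pQ pI pU.
have e2 : psi (volume P) + psi (volume Q) = psi (volume (P `|` Q)) + psi (volume (P `&` Q)).
  by rewrite -!cpsi ?volume_ge0// (volume_valuation pP pQ pI pU).
have e3 : \1_P 0 + \1_Q 0 = \1_(P `|` Q) 0 + \1_(P `&` Q) 0 :> R.
  rewrite !indicE in_setU in_setI.
  by case: (0 \in P); case: (0 \in Q); rewrite /= ?addr0 ?add0r.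
have e4 : phi (volume (conv_hull ([set 0] `|` P))) + phi (volume (conv_hull ([set 0] `|` Q))) =
    phi (volume (conv_hull ([set 0] `|` (P `|` Q)))) +
    phi (volume (conv_hull ([set 0] `|` (P `&` Q)))).
  rewrite -!cphi ?volume_ge0//; congr phi.
  rewrite conv_hull0U_setU// conv_hull0U_setI//; apply: volume_valuation.
  - exact: polytope0U.
  - exact: polytope0U.
  - by rewrite -conv_hull0U_setI//; exact: polytope0U.
  - by rewrite -conv_hull0U_setU//; exact: polytope0U.
by have := congr1 ( *%R c0') e1; have := congr1 ( *%R d0) e3; rewrite /= !mulrDr; lra.
Qed.

Lemma standard_functional_SL : SL_invariant (@polytope R V) standard_functional.
Proof.
move=> A P dA pP; rewrite /standard_functional -!/(relint_sign _) relint_sign_SL//.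
have uA : A \in unitmx by rewrite unitmxE dA unitr1.
have [s s0 PE] := pP; rewrite -/(hull s) in PE.
have s0' : map (mulmx A) s != [::] by case: s s0 {PE}.
have pAP : polytope [set A *m x | x in P] by rewrite PE hull_map; exact: hull_polytope.
rewrite !euler_char_polytope//.
have -> : \1_[set A *m x | x in P] 0 = \1_P 0 :> R.
  rewrite !indicE; congr ((nat_of_bool _)%:R); apply/idP/idP; rewrite !inE.
    move=> [x Px Bx].
    by move: Bx Px => /(congr1 (mulmx (invmx A))); rewrite mulmx0 mulKmx// => ->.
  by move=> P0; exists 0 => //; rewrite mulmx0.
rewrite PE hull_map volume_SL// !hull_set0U//.
have -> : hull (0 :: map (mulmx A) s) = hull (map (mulmx A) (0 :: s)).
  by rewrite /= mulmx0.
by rewrite volume_SL.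
Qed.

End Formula.

(** * Every SL(n) invariant valuation has the standard form *)

Section Classification.
Context (R : realType) (n : nat).
Local Notation V := 'cV[R]_n.
Hypothesis n2 : (1 < n)%N.

Lemma valuation_cut_function (Psi : set V -> R) :
  valuation (@polytope R V) Psi -> cut_function (fun s => Psi (hull s)).
Proof.
move=> vPsi; split=> [s s' ->//|p q s l z l0 l1 zE].
rewrite (hull_cutU s l0 l1 zE) -(hull_cutI s l0 l1 zE); apply/esym/vPsi.
- exact: hull_polytope.
- exact: hull_polytope.
- by rewrite (hull_cutI s l0 l1 zE); exact: hull_polytope.
- by rewrite -(hull_cutU s l0 l1 zE); exact: hull_polytope.
Qed.

Lemma SL_invariant_hull (Psi : set V -> R) : SL_invariant (@polytope R V) Psi ->
  forall (A : 'M[R]_n) s, \det A = 1 -> s != [::] ->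
    Psi (hull (map (mulmx A) s)) = Psi (hull s).
Proof. by move=> iPsi A s dA s0; rewrite -hull_map iPsi//; exact: hull_polytope. Qed.

Lemma in_cone_span (s : seq V) x t : in_cone s x t -> x \in << s >>%VS.
Proof.
elim: s x t => [|p s IH] x t /=; first by move=> [-> _]; rewrite mem0v.
move=> [c _ /IH h]; rewrite span_cons -[x](subrK (c *: p)) addrC.
by apply: memv_add => //; apply: rpredZ; exact: memv_line.
Qed.

Lemma free_in_cone0 (X : seq V) t : free X -> in_cone X 0 t -> t = 0.
Proof.
elim: X t => [|p s IH] t /=; first by move=> _ [].
rewrite free_cons => /andP[ps fs] [c c0 h].
have [c00|cN] := eqVneq c 0.
  by move: h; rewrite c00 scale0r !subr0; exact: IH.
exfalso; move/negP: ps; apply; have /in_cone_span := h.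
rewrite sub0r rpredN => /(rpredZ c^-1).
by rewrite scalerA mulVf// scale1r.
Qed.

Lemma free_hull0 (X : seq V) : free X -> ~ hull X 0.
Proof. by move=> fX /hullE/(free_in_cone0 fX)/eqP; rewrite oner_eq0. Qed.

(** The vertex [p] is a feasible direction at 0 and [- p] is not: otherwise adding a multiple of [p]
    would write 0 as a conical combination of positive height of independent vectors. *)
Lemma free_relint_sign (X : seq V) : free X -> X != [::] ->
  relint_sign (hull (0 :: X)) = 0.
Proof.
case: X => [//|p X] fX _; have cH := @hull_is_convex R n (0 :: p :: X).
have H0 : hull (0 :: p :: X) 0 by apply: hull_mem; exact: mem_head.
rewrite relint_signE// asboolT// cone_signF// => /(_ p)[].
  by exists 1 => //; rewrite scale1r; apply: hull_mem; rewrite !inE eqxx orbT.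
move=> e e0 /hullE[c c0]; rewrite scaler0 subr0 -/(in_cone (p :: X) _ _) => h.
have hp : in_cone (p :: X) p 1 by apply: in_cone_mem; exact: mem_head.
have := in_coneD h (in_coneZ (ltW e0) hp).
rewrite scalerN addNr => /(free_in_cone0 fX).
by have := in_cone_ge0 h; lra.
Qed.

Lemma hull1 (p x : V) : hull [:: p] x -> x = p.
Proof.
move=> /hullE[c c0 [/eqP + /eqP]]; rewrite !subr_eq0 => /eqP -> /eqP <-.
by rewrite scale1r.
Qed.

Lemma relint_sign_point : relint_sign (hull [:: 0 : V]) = 1.
Proof.
have H0 : hull [:: 0 : V] 0 by apply: hull_mem; exact: mem_head.
have cH := @hull_is_convex R n [:: 0].
rewrite relint_signE// asboolT//.
have TE : tangent_cone (hull [:: 0 : V]) = [set 0].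
  apply/seteqP; split=> x; last by move=> ->; exists 1 => //; rewrite scaler0.
  move=> [e e0 /hull1/eqP]; rewrite scaler_eq0 gt_eqF//= => /eqP.
  by [].
have sT : centrally_symmetric (tangent_cone (hull [:: 0 : V])).
  by rewrite TE => x ->; rewrite oppr0.
rewrite cone_signT//.
have := symmetric_cone_direction (tangent_cone_cone cH H0) sT; rewrite TE => DE.
suff -> : direction [set (0 : V)] = 0%VS by rewrite dimv0.
apply/vspaceP => x; rewrite memv0; apply/idP/eqP => [xD|->]; last by rewrite mem0v.
have : [set` direction [set (0 : V)]] x := xD.
by rewrite DE.
Qed.

Let i0 : 'I_n := Ordinal (ltnW n2).
Let i1 : 'I_n := Ordinal n2.

Definition std_basis : seq V := [seq delta_mx i 0 | i <- enum 'I_n].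

Lemma size_std_basis : size std_basis = n.
Proof. by rewrite size_map size_enum_ord. Qed.

Lemma std_basis_sum (x : V) : x = \sum_i x i 0 *: delta_mx i 0.
Proof. by rewrite {1}[x]matrix_sum_delta; apply: eq_bigr => j _; rewrite big_ord1. Qed.

Lemma std_basis_free : free std_basis.
Proof.
rewrite /free size_std_basis; have -> : <<std_basis>>%VS = fullv.
  apply/eqP; rewrite eqEsubv subvf; apply/subvP => x _.
  rewrite [x]std_basis_sum; apply: rpred_sum => i _; apply: rpredZ; apply: memv_span.
  by apply: map_f; rewrite mem_enum.
by rewrite dimvf dim_matrix; apply/eqP; exact: muln1.
Qed.

Lemma exists_list_det (d : R) : 0 < d ->
  exists X : seq V, [/\ free X, size X = n & `|list_det X| = d].
Proof.
have := std_basis_free; have := size_std_basis.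
case: std_basis => [n0 _|e E sE fE d0]; first by exfalso; move: n2; rewrite -n0.
have dE := list_det_neq0 fE sE.
exists (d / list_det (e :: E) *: e :: E); split => //.
  rewrite -[_ *: e]addr0; apply: free_head_comb (mem0v _) => //.
  by rewrite mulf_neq0 ?invr_eq0// gt_eqF.
by rewrite list_detZ ?divfK ?gtr0_norm// ltnW.
Qed.

(** * Volumes of the special simplices *)

Lemma volume_flat (s : seq V) (i : 'I_n) (a : R) : (forall p, p \in s -> p i 0 = a) ->
  volume (hull s) = 0.
Proof.
move=> si; have [M M0 HM] := hull_bounded s.
(* A bounding box whose side in direction [i] has length 0. *)
pose lo j := if j == i then a else - M; pose hi j := if j == i then a else M.
have lohi j : lo j <= hi j by rewrite /lo /hi; case: eqP => // _; lra.
apply/eqP; rewrite eq_le volume_ge0 andbT.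
have -> : 0 = \prod_j (hi j - lo j) by rewrite (bigD1 i)//= /lo /hi eqxx subrr mul0r.
apply: volume_sub_box => // x hx j; rewrite /lo /hi; case: eqP => [->|_]; last exact: HM.
suff -> : x i 0 = a by rewrite lexx.
pose C := [set y : V | y i 0 = a].
apply: (@hull_sub_convex _ _ s C) => // y z t _ _; rewrite /C /= !mxE => -> ->.
by ring.
Qed.

(** Volume is itself an SL(n) invariant valuation, so the orbit arguments above determine it on
    simplices. *)
Let cutV := valuation_cut_function (@volume_valuation R n).
Let SLV := fun (A : 'M[R]_n) s (dA : \det A = 1) (_ : s != [::]) => volume_SL s dA.

(** By the orbit argument the value is that of a segment on a coordinate axis, which is flat. *)
Lemma volume_low (X : seq V) : free X -> (size X < n)%N ->
  volume (hull (0 :: X)) = 0.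
Proof.
move=> fX sX; have [->|X0] := eqVneq X [::].
  by apply: (@volume_flat _ i0 0) => p; rewrite inE => /eqP ->; rewrite mxE.
pose v : V := delta_mx i1 0.
have v0 : v != 0.
  by apply/eqP => /matrixP/(_ i1 0)/eqP; rewrite !mxE !eqxx oner_eq0.
have := @cut_constant_low _ _ n2 _ cutV SLV [:: 0] (or_intror erefl) X v fX.
rewrite lt0n size_eq0 X0 sX => /(_ erefl v0) E.
rewrite (@eq_mem_hull _ _ _ (X ++ [:: 0])); last first.
  by move=> x; rewrite mem_cat !inE orbC.
rewrite E; apply: (@volume_flat _ i0 0) => p; rewrite !inE => /orP[] /eqP ->; rewrite !mxE//.
Qed.

(** Below full size the hull lies in a flat simplex. At full size the volume is a nonnegative Cauchy
    function of the determinant, hence linear, and it vanishes because the hull of the standard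
    basis can be sheared into a coordinate hyperplane. *)
Lemma volume_special (X : seq V) : free X -> X != [::] -> volume (hull X) = 0.
Proof.
move=> fX X0; have [f [cf f0 fE]] := @cut_cauchy_top _ _ n2 _ cutV SLV [::] (or_introl erefl).
have [sX|sX] := ltnP (size X) n.
  apply/eqP; rewrite eq_le volume_ge0 andbT -(volume_low fX sX).
  by apply: volume_le; apply: sub_hull => p pX; apply: hull_mem; rewrite inE pX orbT.
have {}sX : size X = n.
  by apply/eqP; rewrite eqn_leq sX free_size.
pose v : V := delta_mx i0 0.
have v0 : v != 0.
  by apply/eqP => /matrixP/(_ i0 0)/eqP; rewrite !mxE !eqxx oner_eq0.
have vv : volume (hull [:: v]) = 0.
  by apply: (@volume_flat _ i1 0) => p; rewrite inE => /eqP ->; rewrite !mxE.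
have fV (Y : seq V) : free Y -> size Y = n -> volume (hull Y) = f `|list_det Y|.
  by move=> fY sY; rewrite -{1}[Y]cats0 (fE Y v)// vv add0r.
have fge0 x : 0 <= x -> 0 <= f x.
  rewrite le_eqVlt => /orP[/eqP <-|x0]; first by rewrite f0.
  by have [Y [fY sY <-]] := exists_list_det x0; rewrite -fV// volume_ge0.
have flin := cauchy_ge0_linear cf fge0.
rewrite (fV _ fX sX) flin//.
suff -> : f 1 = 0 by rewrite mulr0.
have m0 : (n.-1 < n)%N by rewrite (prednK (ltnW n2)).
(* B shears the standard basis into the hyperplane where the last coordinate is 1. *)
pose B : 'M[R]_n := \matrix_(i, j) ((i == j) || (i == Ordinal m0))%:R.
have dB : \det B = 1.
  rewrite det_trig; first by apply: big1 => i _; rewrite mxE eqxx.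
  apply/is_trig_mxP => i j ij; rewrite mxE.
  case: eqP => [ij'|_]; first by rewrite ij' ltnn in ij.
  case: eqP => // im; move: ij; rewrite im /= ltnNge; case/negP.
  by rewrite -ltnS (prednK (ltnW n2)).
have E0 : std_basis != [::] by rewrite -size_eq0 size_std_basis -lt0n ltnW.
have : volume (hull std_basis) = 0.
  rewrite -(volume_SL _ dB); apply: (@volume_flat _ (Ordinal m0) 1).
  by move=> p /mapP[q /mapP[j _ ->] ->]; rewrite -colE !mxE eqxx orbT.
rewrite (fV _ std_basis_free size_std_basis) flin// => /eqP.
by rewrite mulf_eq0 normr_eq0 (negbTE (list_det_neq0 std_basis_free size_std_basis)) => /eqP.
Qed.

(** Linear in the determinant by nonnegativity. The positive factor [k] serves to turn functions of
    the determinant into functions of the volume. *)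
Lemma volume_simplex : exists2 k : R, 0 < k &
  forall X : seq V, free X -> size X = n -> volume (hull (0 :: X)) = k * `|list_det X|.
Proof.
have [f [cf f0 fE]] := @cut_cauchy_top _ _ n2 _ cutV SLV [:: 0] (or_intror erefl).
pose v : V := delta_mx i0 0.
have v0 : v != 0.
  by apply/eqP => /matrixP/(_ i0 0)/eqP; rewrite !mxE !eqxx oner_eq0.
have vv : volume (hull [:: v; 0]) = 0.
  by apply: (@volume_flat _ i1 0) => p; rewrite !inE => /orP[] /eqP ->; rewrite !mxE.
have fV (Y : seq V) : free Y -> size Y = n -> volume (hull (0 :: Y)) = f `|list_det Y|.
  move=> fY sY; rewrite -[RHS]add0r -vv -(fE Y v)//; congr volume.
  by apply: eq_mem_hull => x; rewrite mem_cat !inE orbC.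
have fge0 x : 0 <= x -> 0 <= f x.
  rewrite le_eqVlt => /orP[/eqP <-|x0]; first by rewrite f0.
  by have [Y [fY sY <-]] := exists_list_det x0; rewrite -fV// volume_ge0.
have flin := cauchy_ge0_linear cf fge0.
exists (f 1); last by move=> X fX sX; rewrite fV// flin// mulrC.
have n0 : 0 < n%:R :> R by rewrite ltr0n ltnW.
have : 0 < volume (hull (0 :: std_basis)).
  (* The cube of side [n%:R^-1] fits into the standard simplex: each of its points is the average of
     the points [n%:R * x i 0] times the [i]-th basis vector. *)
  pose a (i : 'I_n) : R := 0; pose b (i : 'I_n) : R := n%:R^-1.
  have ab i : a i <= b i by rewrite /a /b invr_ge0 ltW.
  apply: (@lt_le_trans _ _ (\prod_i (b i - a i))).
    by apply: prodr_gt0 => i _; rewrite /a /b subr0 invr_gt0.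
  apply: volume_sup_box => // x xb; rewrite [x]std_basis_sum.
  have H0 : hull (0 :: std_basis) 0 by apply: hull_mem; exact: mem_head.
  apply: convex_average => // [|i]; first exact: hull_is_convex.
  have /andP[x0 x1] := xb i.
  have k0 : 0 <= n%:R * x i 0 by rewrite mulr_ge0// ltW.
  have k1 : n%:R * x i 0 <= 1 by rewrite mulrC -ler_pdivlMr// div1r.
  have He : hull (0 :: std_basis) (delta_mx i 0).
    apply: hull_mem; rewrite inE; apply/orP; right.
    by apply: map_f; rewrite mem_enum.
  by have := hull_convex k0 k1 He H0; rewrite scaler0 addr0 scalerA.
rewrite (fV _ std_basis_free size_std_basis) flin//.
by rewrite pmulr_rgt0// normr_gt0 (list_det_neq0 std_basis_free size_std_basis).
Qed.

Lemma polytope_functional_eq0 (D : set V -> R) : valuation (@polytope R V) D ->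
  (forall X, free X -> X != [::] -> D (hull X) = 0) ->
  (forall X, free X -> D (hull (0 :: X)) = 0) ->
  forall P, polytope P -> D P = 0.
Proof.
move=> vD D1 D2 P [s s0 ->].
by apply: (cut_function_eq0 (F := fun s => D (hull s))) => //; exact: valuation_cut_function.
Qed.

Lemma standard_functional_special c0 c0' d0 (phi psi : R -> R) (X : seq V) :
  free X -> X != [::] -> cauchy_solution psi ->
  standard_functional c0 c0' d0 phi psi (hull X) = c0 + phi (volume (hull (0 :: X))).
Proof.
move=> fX X0 cpsi; have nX := free_hull0 fX.
rewrite /standard_functional -/(relint_sign _) euler_char_polytope; last exact: hull_polytope.
rewrite relint_signE; last exact: hull_is_convex.
rewrite asboolF// volume_special// (cauchy_solution0 cpsi) indicE memNset//.
by rewrite hull_set0U//=; ring.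
Qed.

(** Among these simplices only the point 0 has 0 in its relative interior. *)
Lemma standard_functional_special0 c0 c0' d0 (phi psi : R -> R) (X : seq V) :
  free X ->
  standard_functional c0 c0' d0 phi psi (hull (0 :: X)) =
  c0 + c0' * (X == [::])%:R + d0 + psi (volume (hull (0 :: X)))
  + phi (volume (hull (0 :: X))).
Proof.
move=> fX; have H0 : hull (0 :: X) 0 by apply: hull_mem; exact: mem_head.
rewrite /standard_functional -/(relint_sign _) euler_char_polytope; last exact: hull_polytope.
rewrite indicE mem_set// hull_set0U//.
have -> : hull [:: 0, 0 & X] = hull (0 :: X).
  by apply: eq_mem_hull => x; rewrite !inE orbA orbb.
have -> : relint_sign (hull (0 :: X)) = (X == [::])%:R.
  by case: eqVneq => [->|X0]; rewrite ?relint_sign_point// free_relint_sign.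
by rewrite /=; ring.
Qed.

Lemma SL_valuation_standard (Psi : set V -> R) :
  valuation (@polytope R V) Psi -> SL_invariant (@polytope R V) Psi ->
  exists (c0 c0' d0 : R) (phi psi : R -> R),
    [/\ cauchy_solution phi, cauchy_solution psi &
      forall P, polytope P -> Psi P = standard_functional c0 c0' d0 phi psi P].
Proof.
move=> vPsi iPsi.
have cutF := valuation_cut_function vPsi; have SLF := SL_invariant_hull iPsi.
have [f1 [cf1 f10 f1E]] := @cut_cauchy_top _ _ n2 _ cutF SLF [::] (or_introl erefl).
have [f2 [cf2 f20 f2E]] := @cut_cauchy_top _ _ n2 _ cutF SLF [:: 0] (or_intror erefl).
have low1 := @cut_constant_low _ _ n2 _ cutF SLF [::] (or_introl erefl).
have low2 := @cut_constant_low _ _ n2 _ cutF SLF [:: 0] (or_intror erefl).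
have [k k0 kE] := volume_simplex.
pose e : V := delta_mx i0 0.
have e0 : e != 0.
  by apply/eqP => /matrixP/(_ i0 0)/eqP; rewrite !mxE !eqxx oner_eq0.
pose al := Psi (hull [:: e]); pose be := Psi (hull [:: e; 0]); pose ga := Psi (hull [:: 0]).
(* Without the vertex 0 only [phi] sees the determinant, so [f1] gives [phi]; with it [phi] and
   [psi] add up to [f2]. Dividing by [k] passes from volume to determinant. *)
pose phi x := f1 (x / k); pose psi x := f2 (x / k) - f1 (x / k).
have cphi : cauchy_solution phi.
  by move=> x y x0 y0; rewrite /phi mulrDl cf1// divr_ge0// ltW.
have cpsi : cauchy_solution psi.
  move=> x y x0 y0; rewrite /psi mulrDl cf1 ?cf2 ?divr_ge0 ?(ltW k0)//; ring.
(* Solves [c0 = al] on points other than 0, [c0 + d0 = be] on segments ending at 0, and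
   [c0 + c0' + d0 = ga] on the point 0. *)
exists al, (ga - be), (be - al), phi, psi; split => // P pP.
set G := standard_functional _ _ _ _ _.
have vG : valuation (@polytope R V) G by exact: standard_functional_valuation.
have cat0 (X : seq V) : hull (X ++ [:: 0]) = hull (0 :: X).
  by apply: eq_mem_hull => x; rewrite mem_cat !inE orbC.
apply/eqP; rewrite -subr_eq0; apply/eqP.
apply: (@polytope_functional_eq0 (fun P => Psi P - G P)) => //.
- move=> A B pA pB pI pU.
  by have := vPsi A B pA pB pI pU; have := vG A B pA pB pI pU; lra.
- move=> X fX X0; rewrite /G standard_functional_special//.
  have := free_size fX; rewrite leq_eqVlt => /orP[/eqP sX|sX].
    rewrite kE// -[X in hull X]cats0 (f1E X e)// /phi mulrC mulKf ?gt_eqF//.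
    by rewrite -/al; ring.
  rewrite -{1}[X in hull X]cats0 (low1 X e)// ?lt0n ?size_eq0 ?X0//.
  by rewrite volume_low// (cauchy_solution0 cphi) -/al; ring.
- move=> X fX; rewrite /G standard_functional_special0//.
  have [->|X0] := eqVneq X [::].
    rewrite (volume_low (X := [::])) ?nil_free//; last exact: ltnW.
    by rewrite (cauchy_solution0 cphi) (cauchy_solution0 cpsi) -/ga /=; ring.
  have := free_size fX; rewrite leq_eqVlt => /orP[/eqP sX|sX].
    rewrite kE// -cat0 (f2E X e)// /phi /psi (mulrC k) mulfK ?gt_eqF//.
    by rewrite -/be /=; ring.
  rewrite volume_low// -cat0 (low2 X e)// ?lt0n ?size_eq0 ?X0//.
  by rewrite (cauchy_solution0 cphi) (cauchy_solution0 cpsi) -/be /=; ring.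
Qed.

End Classification.

Theorem theorem2 (R : realType) (n : nat) (hn : (2 <= n)%N)
    (Psi : set 'cV[R]_n -> R) :
  (valuation (@polytope R 'cV[R]_n) Psi /\
   SL_invariant (@polytope R 'cV[R]_n) Psi)
  <->
  exists (c0 c0' d0 : R) (phi psi : R -> R),
    [/\ cauchy_solution phi, cauchy_solution psi &
      forall P : set 'cV[R]_n, polytope P ->
        Psi P = c0 * euler_char P
                + c0' * ((-1) ^+ affdim P * \1_(relint P) 0)
                + psi (volume P)
                + d0 * \1_P 0
                + phi (volume (conv_hull ([set 0] `|` P)))].
Proof.
split=> [[vPsi iPsi]|[c0 [c0' [d0 [phi [psi [cphi cpsi PsiE]]]]]]].
  exact: SL_valuation_standard.
have {}PsiE P : polytope P -> Psi P = standard_functional c0 c0' d0 phi psi P.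
  exact: PsiE.
split=> [P Q pP pQ pI pU|A P dA pP].
  by rewrite !PsiE//; exact: standard_functional_valuation.
rewrite !PsiE//; first exact: standard_functional_SL.
have [s s0 ->] := pP; rewrite -/(hull s) hull_map; apply: hull_polytope.
by case: s s0.
Qed.
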